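(* There exists a left-computable real number $x$ which is nearly computable but not regainingly approximable.
   Context: A real number is left-computable if there is a computable non-decreasing sequence of rational numbers converging to it. A real $x$ is regainingly approximable if there is a computable non-decreasing sequence of rationals $(x_n)_n$ converging to $x$ with $x - x_n < 2^{-n}$ for infinitely many $n\in\mathbb{N}$. A function $f:\mathbb{N}\to\mathbb{N}$ is a modulus of convergence of a convergent sequence $(y_n)_n$ with limit $y$ if for all $n$ and all $m\ge f(n)$ we have $|y-y_m|<2^{-n}$; $(y_n)_n$ converges computably if it has a computable modulus of convergence. A sequence $(x_n)_n$ converges nearly computably if it converges and for every computable increasing function $s:\mathbb{N}\to\mathbb{N}$ the sequence $(x_{s(n+1)}-x_{s(n)})_n$ converges computably to $0$. A real is nearly computable if some computable sequence of rationals converges nearly computably to it. *)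

(* Defs.v *)
From HB Require Import structures.
From mathcomp Require Import all_boot all_order all_algebra.
From mathcomp Require Import all_classical all_reals all_analysis.
Set Implicit Arguments. Unset Strict Implicit. Unset Printing Implicit Defensive.
Import Order.TTheory GRing.Theory Num.Theory.
Import numFieldNormedType.Exports.
Local Open Scope classical_set_scope.
Local Open Scope ring_scope.

(** * A model of computation: Kleene's partial recursive functions.
    Arguments are passed as a list of naturals; projections out of range
    return 0 (harmless padding convention). *)
Inductive prf : Type :=
| PZero : prf
| PSucc : prf
| PProj : nat -> prf
| PComp : prf -> list prf -> prf
| PPrim : prf -> prf -> prf
| PMu   : prf -> prf.

Inductive eval : prf -> seq nat -> nat -> Prop :=
| ev_zero v : eval PZero v 0
| ev_succ x v : eval PSucc (x :: v) x.+1
| ev_proj i v : eval (PProj i) v (nth 0%N v i)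
| ev_comp f gs v ys y : evals gs v ys -> eval f ys y -> eval (PComp f gs) v y
| ev_prim0 f g v y : eval f v y -> eval (PPrim f g) (0%N :: v) y
| ev_primS f g n v y z :
    eval (PPrim f g) (n :: v) y -> eval g (n :: y :: v) z ->
    eval (PPrim f g) (n.+1 :: v) z
| ev_mu f v n :
    eval f (n :: v) 0 ->
    (forall m, (m < n)%N -> exists k, eval f (m :: v) k.+1) ->
    eval (PMu f) v n
with evals : list prf -> seq nat -> seq nat -> Prop :=
| evs_nil v : evals nil v [::]
| evs_cons g gs v y ys : eval g v y -> evals gs v ys -> evals (g :: gs) v (y :: ys).

Definition computable_nat (f : nat -> nat) : Prop :=
  exists p : prf, forall n, eval p [:: n] (f n).

Definition computable_qseq (q : nat -> rat) : Prop :=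
  exists a b c : nat -> nat,
    [/\ computable_nat a, computable_nat b, computable_nat c &
        forall n, q n = ((a n)%:R - (b n)%:R) / (c n).+1%:R].

Definition nondecreasing_qseq (q : nat -> rat) : Prop :=
  forall n, q n <= q n.+1.

Definition is_modulus {R : realType} (y : nat -> R) (l : R) (f : nat -> nat) : Prop :=
  forall n m, (f n <= m)%N -> `|l - y m| < (2%:R ^- n : R).

Definition converges_computably {R : realType} (y : nat -> R) (l : R) : Prop :=
  exists f, computable_nat f /\ is_modulus y l f.

Definition left_computable {R : realType} (x : R) : Prop :=
  exists q : nat -> rat, [/\ computable_qseq q, nondecreasing_qseq q &
    (fun n => (ratr (q n) : R)) @ \oo --> x].

Definition regainingly_approximable {R : realType} (x : R) : Prop :=
  exists q : nat -> rat, [/\ computable_qseq q, nondecreasing_qseq q,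
    (fun n => (ratr (q n) : R)) @ \oo --> x &
    forall N, exists2 n, (N <= n)%N & x - ratr (q n) < (2%:R ^- n : R)].

Definition converges_nearly_computably {R : realType} (q : nat -> rat) (x : R) : Prop :=
  (fun n => (ratr (q n) : R)) @ \oo --> x /\
  forall s : nat -> nat, computable_nat s -> (forall n, (s n < s n.+1)%N) ->
    converges_computably (fun n => (ratr (q (s n.+1)) - ratr (q (s n)) : R)) 0.

Definition nearly_computable {R : realType} (x : R) : Prop :=
  exists q : nat -> rat, computable_qseq q /\ converges_nearly_computably q x.

(* Main.v *)
From mathcomp Require Import all_boot all_order all_algebra.
From mathcomp Require Import all_classical all_reals all_analysis.
From mathcomp Require Import zify ring lra.
Require Import Defs.

(** Running all programs in parallel gives computable clocks [clock e t], nondecreasing in [t],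
    such that every computable [g] has an index [e] whose clock is unbounded and exceeds [a]
    only after stage [g a].  The number is the limit of
    [xseq t = \sum_(i, j) 2^-(i+j) * filled i j t], where request [(i, j)] is raised once
    clock [i] exceeds [j] and is then filled gradually from [0] to [1].

    If [q] showed the limit [x] to be regainingly approximable, let [r n] be the first stage
    with [q n - 2^-n < xseq (r n)], so that [x - xseq (r n) < 2^(1-n)] infinitely often.  A
    clock [i] slower than [r] raises request [(i, j)] only after stage [r n] for
    [n = 2j+1, 2j+2], so that [x - xseq (r n) >= 2^-(i+j) >= 2^(1-n)] as soon as [j] is at
    least [i] and the request is eventually filled: a contradiction.

    For near computability the filling of [(i, j)] is organised in nested loops, one for each
    [e <= i], loop [0] innermost.  A loop entered at stage [t] makes [t+1] steps of equal size,
    and between two steps of loop [e] each clock [e' <= e] has to exceed the stage of the last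
    firing.  If clock [e] is slower than [s], then at most one step of loop [e] falls into an
    interval from [s n] to [s (n+1)], and such steps become computably small.  A bounded clock
    must not block the requests: clock [e'] is ignored as long as it is at most [i+j], so it
    blocks finitely many requests only, and only in loops [e >= e'].  This is why each [s] gets
    a computable modulus, although not uniformly in [s]. *)

Set Implicit Arguments. Unset Strict Implicit. Unset Printing Implicit Defensive.
Import Order.TTheory GRing.Theory Num.Theory.
Import numFieldNormedType.Exports.

(** * Computable functions *)

(* Argument lists as left-nested tuples [unit * nat * ... * nat]: the last component is the head
   of the list, which is the argument that [PPrim] and [PMu] operate on. *)
Class Env (A : Type) := MkEnv
  { arity : nat; enc : A -> seq nat; size_enc : forall a, size (enc a) = arity }.

#[global] Instance Env_unit : Env unit := @MkEnv unit 0 (fun=> [::]) (fun=> erefl).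
#[global, refine] Instance Env_ext (A : Type) (EA : Env A) : Env (A * nat) :=
  @MkEnv (A * nat) (@arity A EA).+1 (fun z => z.2 :: enc z.1) _.
Proof. by move=> z /=; rewrite size_enc. Defined.

Definition Comp (A : Type) {EA : Env A} (f : A -> nat) : Prop :=
  exists p, forall a, eval p (enc a) (f a).

(** Composition passes arguments only through explicit programs; these projections forward an
    environment after dropping its first [size w] entries. *)
Lemma evals_proj w v :
  evals (map PProj (iota (size w) (size v))) (w ++ v) v.
Proof.
elim: v w => [|x v IH] w /=; first exact: evs_nil.
apply: evs_cons.
  by have := ev_proj (size w) (w ++ x :: v); rewrite nth_cat ltnn subnn.
by have := IH (rcons w x); rewrite size_rcons cat_rcons.
Qed.

Section Closure.
Context {A : Type} {EA : Env A}.
Implicit Types (f g h : A -> nat) (P Q : A -> bool).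

Lemma Comp_ext f g : f =1 g -> Comp g -> Comp f.
Proof. by move=> fg [p Hp]; exists p => a; rewrite fg. Qed.

Lemma Comp_var : Comp (fun z : A * nat => z.2).
Proof. exists (PProj 0) => a; exact: (ev_proj 0 (enc a)). Qed.

Lemma Comp_weak f : Comp f -> Comp (fun z : A * nat => f z.1).
Proof.
move=> [p Hp]; exists (PComp p (map PProj (iota 1 (@arity A EA)))) => -[a n].
apply: ev_comp (Hp a); rewrite -(size_enc a).
exact: (evals_proj [:: n] (enc a)).
Qed.

(** In the step of [Comp_rec] the accumulator sits between the environment and the counter; this
    skips it. *)
Lemma Comp_skip (F : A -> nat -> nat) :
  Comp (fun z : A * nat => F z.1 z.2) -> Comp (fun z : A * nat * nat => F z.1.1 z.2).
Proof.
move=> [p Hp].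
exists (PComp p (map PProj (0 :: iota 2 (@arity A EA)))) => -[[a y] k].
apply: ev_comp (Hp (a, k)); rewrite /=; apply: evs_cons; first exact: (ev_proj 0).
by rewrite -(size_enc a); exact: (evals_proj [:: k; y] (enc a)).
Qed.

Lemma Comp_subst (F : A -> nat -> nat) f :
  Comp (fun z : A * nat => F z.1 z.2) -> Comp f -> Comp (fun a => F a (f a)).
Proof.
move=> [p Hp] [q Hq]; exists (PComp p (q :: map PProj (iota 0 (@arity A EA)))) => a.
apply: ev_comp (Hp (a, f a)); apply: evs_cons => //.
by rewrite -(size_enc a); exact: (evals_proj [::] (enc a)).
Qed.

Lemma Comp_succ f : Comp f -> Comp (fun a => (f a).+1).
Proof.
move=> [p Hp]; exists (PComp PSucc [:: p]) => a.
by apply: (@ev_comp _ _ _ [:: f a]); [apply: evs_cons (evs_nil _)|apply: ev_succ].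
Qed.

Lemma Comp_const n : Comp (fun _ : A => n).
Proof.
elim: n => [|n IH]; last exact: Comp_succ.
exists PZero => a; exact: ev_zero.
Qed.

(** Computability needs to be proved only once, in the closed environment [unit * nat], and can then
    be used in every environment. *)
Lemma Comp_app1 (k : nat -> nat) f :
  Comp (fun z : unit * nat => k z.2) -> Comp f -> Comp (fun a => k (f a)).
Proof.
move=> [p Hp] [q Hq]; exists (PComp p [:: q]) => a.
by apply: ev_comp (Hp (tt, f a)); apply: evs_cons (evs_nil _).
Qed.

Lemma Comp_app2 (k : nat -> nat -> nat) f g :
  Comp (fun z : unit * nat * nat => k z.1.2 z.2) -> Comp f -> Comp g ->
  Comp (fun a => k (f a) (g a)).
Proof.
move=> [p Hp] [q Hq] [r Hr]; exists (PComp p [:: r; q]) => a.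
apply: ev_comp (Hp (tt, f a, g a)).
by apply: evs_cons => //; apply: evs_cons (evs_nil _).
Qed.

Lemma Comp_app3 (k : nat -> nat -> nat -> nat) f g h :
  Comp (fun z : unit * nat * nat * nat => k z.1.1.2 z.1.2 z.2) ->
  Comp f -> Comp g -> Comp h -> Comp (fun a => k (f a) (g a) (h a)).
Proof.
move=> [p Hp] [q Hq] [r Hr] [s Hs]; exists (PComp p [:: s; r; q]) => a.
apply: ev_comp (Hp (tt, f a, g a, h a)).
by apply: evs_cons => //; apply: evs_cons => //; apply: evs_cons (evs_nil _).
Qed.

(** The recursion equations are hypotheses on a given [F], so that existing fixpoints and iterated
    operations need not be redefined. *)
Lemma Comp_rec (F : A -> nat -> nat) (b : A -> nat) (s : A -> nat -> nat -> nat) n :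
  (forall a, F a 0 = b a) -> (forall a k, F a k.+1 = s a k (F a k)) ->
  Comp b -> Comp (fun z : A * nat * nat => s z.1.1 z.2 z.1.2) -> Comp n ->
  Comp (fun a => F a (n a)).
Proof.
move=> F0 FS [pb Hb] [ps Hs] [pn Hn].
exists (PComp (PPrim pb ps) (pn :: map PProj (iota 0 (@arity A EA)))) => a.
apply: (@ev_comp _ _ _ (n a :: enc a)).
  by apply: evs_cons => //; rewrite -(size_enc a); apply: (evals_proj [::]).
elim: (n a) => [|k IH]; first by rewrite F0; apply: ev_prim0.
by rewrite FS; apply: ev_primS IH (Hs (a, F a k, k)).
Qed.


End Closure.

Section Logic.
Context {A : Type} {EA : Env A}.
Implicit Types (f g h : A -> nat) (P Q : A -> bool).

(** A case distinction is a primitive recursion of length [P a], at most one, whose step ignores the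
    accumulator. *)
Lemma Comp_if P f g :
  Comp (fun a => nat_of_bool (P a)) -> Comp f -> Comp g ->
  Comp (fun a => if P a then f a else g a).
Proof.
move=> CP Cf Cg.
pose F a k := if k is 0 then g a else f a.
apply: (Comp_ext (g := fun a => F a (P a))); first by move=> a; case: (P a).
by apply: (Comp_rec (F := F) (s := fun a _ _ => f a)) => //; exact: (Comp_weak (Comp_weak Cf)).
Qed.

Lemma Comp_negb P : Comp (fun a => nat_of_bool (P a)) -> Comp (fun a => nat_of_bool (~~ P a)).
Proof.
move=> CP; apply: (Comp_ext (g := fun a => if P a then 0 else 1)).
  by move=> a; case: (P a).
by apply: Comp_if => //; apply: Comp_const.
Qed.

Lemma Comp_andb P Q : Comp (fun a => nat_of_bool (P a)) -> Comp (fun a => nat_of_bool (Q a)) ->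
  Comp (fun a => nat_of_bool (P a && Q a)).
Proof.
move=> CP CQ; apply: (Comp_ext (g := fun a => if P a then Q a : nat else 0)).
  by move=> a; case: (P a).
by apply: Comp_if => //; apply: Comp_const.
Qed.

Lemma Comp_orb P Q : Comp (fun a => nat_of_bool (P a)) -> Comp (fun a => nat_of_bool (Q a)) ->
  Comp (fun a => nat_of_bool (P a || Q a)).
Proof.
move=> CP CQ; apply: (Comp_ext (g := fun a => if P a then 1 else Q a : nat)).
  by move=> a; case: (P a).
by apply: Comp_if => //; apply: Comp_const.
Qed.


End Logic.

Section Quantifiers.
Context {A : Type} {EA : Env A}.
Implicit Types (f g n : A -> nat) (P : A -> nat -> bool).

(** [PMu] searches for a zero, so it is run on the negation of [P]. *)
Lemma Comp_mu P f :
  (forall a, P a (f a)) -> (forall a k, k < f a -> ~~ P a k) ->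
  Comp (fun z : A * nat => nat_of_bool (P z.1 z.2)) -> Comp f.
Proof.
move=> P1 P0 /Comp_negb[p Hp]; exists (PMu p) => a; apply: ev_mu.
  by have := Hp (a, f a); rewrite /= P1.
by move=> k kf; exists 0; have := Hp (a, k); rewrite /= P0.
Qed.

Lemma Comp_all P n :
  Comp n -> Comp (fun z : A * nat => nat_of_bool (P z.1 z.2)) ->
  Comp (fun a => nat_of_bool (all (P a) (iota 0 (n a)))).
Proof.
move=> Cn CP.
pose F a k : nat := all (P a) (iota 0 k).
apply: (Comp_rec (F := F) (b := fun=> 1) (s := fun a k y => if P a k then y else 0)) => //.
- move=> a k; rewrite /F -addn1 iotaD all_cat /= add0n andbT andbC.
  by case: (P a k).
- exact: Comp_const.
apply: Comp_if; last exact: Comp_const.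
  exact: (Comp_skip (F := fun a k => P a k) CP).
exact: (Comp_weak Comp_var).
Qed.

Lemma Comp_has P n :
  Comp n -> Comp (fun z : A * nat => nat_of_bool (P z.1 z.2)) ->
  Comp (fun a => nat_of_bool (has (P a) (iota 0 (n a)))).
Proof.
move=> Cn CP.
apply: (Comp_ext (g := fun a => ~~ all (fun k => ~~ P a k) (iota 0 (n a)) : nat)).
  by move=> a; rewrite all_predC negbK.
by apply: Comp_negb; apply: Comp_all => //; apply: Comp_negb.
Qed.

End Quantifiers.

Lemma Comp_find (A : Type) (EA : Env A) (P : A -> nat -> bool) (n : A -> nat) :
  Comp n -> Comp (fun z : A * nat => nat_of_bool (P z.1 z.2)) ->
  Comp (fun a => find (P a) (iota 0 (n a))).
Proof.
move=> Cn CP.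
pose F a k := find (P a) (iota 0 k).
apply: (Comp_rec (F := F) (b := fun=> 0)
  (s := fun a k y => if has (P a) (iota 0 k) then y else if P a k then y else y.+1)) => //.
- move=> a k; rewrite /F -addn1 iotaD find_cat /= add0n.
  (* [find] returns the length when nothing is found, so here the accumulator is [k] itself. *)
  case: ifP => // H; rewrite (hasNfind (negbT H)) size_iota.
  by case: ifP => _; rewrite ?addn0 ?addn1.
- exact: Comp_const.
have Cy := Comp_weak (Comp_var (A := A)).
apply: Comp_if => //; last first.
  by apply: Comp_if => //; [exact: (Comp_skip (F := fun a k => P a k) CP) | apply: Comp_succ].
apply: (Comp_skip (F := fun a k => has (P a) (iota 0 k) : nat)).
apply: (Comp_has (P := fun z : A * nat => P z.1)); first exact: Comp_var.
exact: (Comp_skip (F := fun a k => P a k) CP).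
Qed.


(** * Arithmetic and comparisons *)

Lemma Comp_pred (A : Type) (EA : Env A) (f : A -> nat) :
  Comp f -> Comp (fun a => (f a).-1).
Proof.
move=> Cf; apply: (Comp_rec (F := fun=> predn) (b := fun=> 0) (s := fun _ k _ => k)) => //.
- exact: Comp_const.
- exact: Comp_var.
Qed.

Lemma Comp_add (A : Type) (EA : Env A) (f g : A -> nat) :
  Comp f -> Comp g -> Comp (fun a => f a + g a).
Proof.
move=> Cf Cg.
apply: (Comp_rec (F := fun a k => f a + k) (b := f) (s := fun _ _ y => y.+1)) => //.
- by move=> a; rewrite addn0.
- by move=> a k; rewrite addnS.
- exact/Comp_succ/(Comp_weak Comp_var).
Qed.

Lemma Comp_sub (A : Type) (EA : Env A) (f g : A -> nat) :
  Comp f -> Comp g -> Comp (fun a => f a - g a).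
Proof.
move=> Cf Cg.
apply: (Comp_rec (F := fun a k => f a - k) (b := f) (s := fun _ _ y => y.-1)) => //.
- by move=> a; rewrite subn0.
- by move=> a k; rewrite subnS.
- exact/Comp_pred/(Comp_weak Comp_var).
Qed.

Lemma Comp_mul (A : Type) (EA : Env A) (f g : A -> nat) :
  Comp f -> Comp g -> Comp (fun a => f a * g a).
Proof.
move=> Cf Cg.
apply: (Comp_rec (F := fun a k => f a * k) (b := fun=> 0) (s := fun a _ y => f a + y)) => //.
- by move=> a; rewrite muln0.
- by move=> a k; rewrite mulnS.
- exact: Comp_const.
- by apply: Comp_add; [exact: (Comp_weak (Comp_weak Cf))|exact: (Comp_weak Comp_var)].
Qed.

Lemma Comp_exp (A : Type) (EA : Env A) (f g : A -> nat) :
  Comp f -> Comp g -> Comp (fun a => f a ^ g a).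
Proof.
move=> Cf Cg.
apply: (Comp_rec (F := fun a k => f a ^ k) (b := fun=> 1) (s := fun a _ y => f a * y)) => //.
- by move=> a k; rewrite expnS.
- exact: Comp_const.
- by apply: Comp_mul; [exact: (Comp_weak (Comp_weak Cf))|exact: (Comp_weak Comp_var)].
Qed.

Lemma Comp_eq0 (A : Type) (EA : Env A) (f : A -> nat) :
  Comp f -> Comp (fun a => nat_of_bool (f a == 0)).
Proof.
move=> Cf; apply: (Comp_ext (g := fun a => 1 - f a)); first by move=> a; case: (f a) => [|[]].
by apply: Comp_sub => //; apply: Comp_const.
Qed.

Lemma Comp_leq (A : Type) (EA : Env A) (f g : A -> nat) :
  Comp f -> Comp g -> Comp (fun a => nat_of_bool (f a <= g a)).
Proof. by move=> Cf Cg; apply/Comp_eq0/Comp_sub. Qed.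

Lemma Comp_eq (A : Type) (EA : Env A) (f g : A -> nat) :
  Comp f -> Comp g -> Comp (fun a => nat_of_bool (f a == g a)).
Proof.
move=> Cf Cg; apply: (Comp_ext (g := fun a => (f a <= g a) && (g a <= f a) : nat)).
  by move=> a; rewrite eqn_leq.
by apply: Comp_andb; apply: Comp_leq.
Qed.

Lemma Comp_v1 (A : Type) (EA : Env A) : Comp (fun z : A * nat * nat => z.1.2).
Proof. exact: (Comp_weak Comp_var). Qed.
Lemma Comp_v2 (A : Type) (EA : Env A) : Comp (fun z : A * nat * nat * nat => z.1.1.2).
Proof. exact: (Comp_weak (@Comp_v1 A EA)). Qed.
Lemma Comp_v3 (A : Type) (EA : Env A) :
  Comp (fun z : A * nat * nat * nat * nat => z.1.1.1.2).
Proof. exact: (Comp_weak (@Comp_v2 A EA)). Qed.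
Lemma Comp_v4 (A : Type) (EA : Env A) :
  Comp (fun z : A * nat * nat * nat * nat * nat => z.1.1.1.1.2).
Proof. exact: (Comp_weak (@Comp_v3 A EA)). Qed.
Lemma Comp_v5 (A : Type) (EA : Env A) :
  Comp (fun z : A * nat * nat * nat * nat * nat * nat => z.1.1.1.1.1.2).
Proof. exact: (Comp_weak (@Comp_v4 A EA)). Qed.

(** A hook for [comp_step], redefined when closure lemmas for further operations are available. *)
Ltac comp_more := fail.

Ltac comp_step :=
  lazymatch goal with
  | |- Comp snd => exact: Comp_var
  | |- Comp (fun z => z.2) => exact: Comp_var
  | |- Comp (fun z => z.1.2) => exact: Comp_v1
  | |- Comp (fun z => z.1.1.2) => exact: Comp_v2
  | |- Comp (fun z => z.1.1.1.2) => exact: Comp_v3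
  | |- Comp (fun z => z.1.1.1.1.2) => exact: Comp_v4
  | |- Comp (fun z => z.1.1.1.1.1.2) => exact: Comp_v5
  | |- Comp (fun z => S _) => refine (Comp_succ _)
  | |- Comp (fun z => predn _) => refine (Comp_pred _)
  | |- Comp (fun z => addn _ _) => refine (Comp_add _ _)
  | |- Comp (fun z => subn _ _) => refine (Comp_sub _ _)
  | |- Comp (fun z => muln _ _) => refine (Comp_mul _ _)
  | |- Comp (fun z => expn _ _) => refine (Comp_exp _ _)
  | |- Comp (fun z => if _ then _ else _) => refine (Comp_if _ _ _)
  | |- Comp (fun z => nat_of_bool (negb _)) => refine (Comp_negb _)
  | |- Comp (fun z => nat_of_bool (andb _ _)) => refine (Comp_andb _ _)
  | |- Comp (fun z => nat_of_bool (orb _ _)) => refine (Comp_orb _ _)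
  | |- Comp (fun z => nat_of_bool (leq _ _)) => refine (Comp_leq _ _)
  | |- Comp (fun z => nat_of_bool (eq_op _ _)) => refine (Comp_eq _ _)
  | |- Comp (fun z => nat_of_bool (all _ (iota 0 _))) => refine (Comp_all _ _)
  | |- Comp (fun z => nat_of_bool (has _ (iota 0 _))) => refine (Comp_has _ _)
  | |- Comp (fun z => find _ (iota 0 _)) => refine (Comp_find _ _)
  | |- _ => first [assumption | comp_more | exact: Comp_const]
  end.
Ltac comp := repeat (cbv beta; comp_step).

(** * Coding pairs and lists *)

(** As [a] is smaller than the gap between the squares of [a + b] and [a + b + 1], the rounded root
    of the code is [a + b] and the excess over the square is [a]. *)
Definition npair (a b : nat) : nat := (a + b) ^ 2 + a.

Lemma ex_nsqrt n : exists k, n < k.+1 ^ 2.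
Proof. by exists n; nia. Qed.

Definition nsqrt (n : nat) : nat := ex_minn (ex_nsqrt n).

Definition nfst (z : nat) : nat := z - nsqrt z ^ 2.
Definition nsnd (z : nat) : nat := nsqrt z - nfst z.

Lemma nsqrt_npair a b : nsqrt (npair a b) = a + b.
Proof.
rewrite /nsqrt /npair; case: ex_minnP => k lt_k /(_ (a + b)) min_k.
by apply/eqP; rewrite eqn_leq min_k /=; nia.
Qed.

Lemma nfst_npair a b : nfst (npair a b) = a.
Proof. by rewrite /nfst nsqrt_npair /npair addKn. Qed.

Lemma nsnd_npair a b : nsnd (npair a b) = b.
Proof. by rewrite /nsnd nfst_npair nsqrt_npair addKn. Qed.

Definition npairE := (nfst_npair, nsnd_npair).

Lemma leq_npairl a b : a <= npair a b.
Proof. by rewrite /npair leq_addl. Qed.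

Lemma leq_npairr a b : b <= npair a b.
Proof. rewrite /npair; nia. Qed.

(** The successor keeps codes of nonempty lists apart from [0], the code of the empty list. *)
Definition lcons (x l : nat) : nat := (npair x l).+1.
Definition nhead (l : nat) : nat := nfst l.-1.
Definition ntail (l : nat) : nat := nsnd l.-1.
(* Reading past the end of a list yields [0]. *)
Definition nnth (l k : nat) : nat := nhead (iter k ntail l).
Definition ncode (s : seq nat) : nat := foldr lcons 0 s.

Lemma nhead_lcons x l : nhead (lcons x l) = x.
Proof. exact: nfst_npair. Qed.

Lemma ntail_lcons x l : ntail (lcons x l) = l.
Proof. exact: nsnd_npair. Qed.

Definition lconsE := (nhead_lcons, ntail_lcons).

Lemma nnth_ncode s k : nnth (ncode s) k = nth 0 s k.
Proof.
rewrite /nnth; elim: s k => [|x s IH] k /=.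
  have nsqrt0 : nsqrt 0 = 0 by rewrite /nsqrt; case: ex_minnP => [[|m]] // _ /(_ 0 isT).
  have h0 : nhead 0 = 0 by [].
  have t0 : ntail 0 = 0 by rewrite /ntail /nsnd nsqrt0.
  by rewrite nth_nil; have -> : iter k ntail 0 = 0 by elim: k => //= k ->.
by case: k => [|k]; rewrite ?nhead_lcons // iterSr ntail_lcons IH.
Qed.

Lemma ltn_ncode s x : x \in s -> x < ncode s.
Proof.
elim: s => //= y s IH; rewrite inE ltnS => /orP[/eqP->|/IH le_xs].
  exact: leq_npairl.
exact: leq_trans (ltnW le_xs) (leq_npairr _ _).
Qed.

Section CompCoding.
Context {A : Type} {EA : Env A}.
Implicit Types (f g : A -> nat).

Lemma Comp_npair f g : Comp f -> Comp g -> Comp (fun a => npair (f a) (g a)).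
Proof. by move=> Cf Cg; rewrite /npair; comp. Qed.

Lemma Comp_nsqrt f : Comp f -> Comp (fun a => nsqrt (f a)).
Proof.
move=> Cf; apply: (Comp_app1 (k := nsqrt)) => //.
apply: (Comp_mu (P := fun z k => z.2 < k.+1 ^ 2)); last by comp.
  by move=> a; rewrite /nsqrt; case: ex_minnP.
move=> a k; rewrite /nsqrt; case: ex_minnP => m _ min_m lt_km.
by apply: contraL lt_km => /min_m; rewrite leqNgt.
Qed.

Lemma Comp_nfst f : Comp f -> Comp (fun a => nfst (f a)).
Proof. by move=> Cf; have := Comp_nsqrt Cf; rewrite /nfst => Cs; comp. Qed.

Lemma Comp_nsnd f : Comp f -> Comp (fun a => nsnd (f a)).
Proof.
by move=> Cf; have := Comp_nfst Cf; have := Comp_nsqrt Cf; rewrite /nsnd => Cs Cs'; comp.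
Qed.

Lemma Comp_lcons f g : Comp f -> Comp g -> Comp (fun a => lcons (f a) (g a)).
Proof. by move=> Cf Cg; rewrite /lcons; exact: Comp_succ (Comp_npair Cf Cg). Qed.

Lemma Comp_nhead f : Comp f -> Comp (fun a => nhead (f a)).
Proof. by move=> Cf; apply: Comp_nfst; apply: Comp_pred. Qed.

Lemma Comp_ntail f : Comp f -> Comp (fun a => ntail (f a)).
Proof. by move=> Cf; apply: Comp_nsnd; apply: Comp_pred. Qed.
End CompCoding.

Lemma Comp_nnth (A : Type) (EA : Env A) (f g : A -> nat) :
  Comp f -> Comp g -> Comp (fun a => nnth (f a) (g a)).
Proof.
move=> Cf Cg; apply: Comp_nhead.
apply: (Comp_rec (F := fun a k => iter k ntail (f a)) (s := fun _ _ y => ntail y)) => //.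
by apply: Comp_ntail; comp.
Qed.

Lemma Comp_mkseq (A : Type) (EA : Env A) (F : A -> nat -> nat) (n : A -> nat) :
  Comp n -> Comp (fun z : A * nat => F z.1 z.2) ->
  Comp (fun a => ncode (mkseq (F a) (n a))).
Proof.
move=> Cn CF.
(* Codes grow at the head, so stage [k] of the recursion holds the last [k] entries. *)
pose G a := nat_rec (fun=> nat) 0 (fun k y => lcons (F a (n a - k.+1)) y).
apply: (Comp_ext (g := fun a => G a (n a))) => [a|].
  suff H k : k <= n a -> G a k = ncode (map (F a) (iota (n a - k) k)).
    by rewrite H // subnn.
  elim: k => [|k IH] // kn; rewrite /= -/(G a k) IH ?(ltnW kn) //.
  by rewrite (_ : (n a - k.+1).+1 = n a - k) //; lia.
apply: (Comp_rec (F := G) (s := fun a k y => lcons (F a (n a - k.+1)) y) _ _ (Comp_const 0)) => //.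
apply: Comp_lcons; last exact: Comp_v1.
apply: (Comp_subst (F := fun z => F z.1.1)).
  exact: (Comp_skip (F := fun z => F z.1) (Comp_skip CF)).
have Cn2 := Comp_weak (Comp_weak Cn); comp.
Qed.

Lemma Comp_prod (A : Type) (EA : Env A) (F : A -> nat -> nat) (n : A -> nat) :
  Comp n -> Comp (fun z : A * nat => F z.1 z.2) -> Comp (fun a => \prod_(i < n a) F a i).
Proof.
move=> Cn CF.
apply: (Comp_rec (F := fun a k => \prod_(i < k) F a i) (b := fun=> 1)
  (s := fun a k y => y * F a k)) => //; last 2 first.
- by comp.
- by have := Comp_skip CF => CF2; comp.
- by move=> a; rewrite big_ord0.
- by move=> a k; rewrite big_ord_recr.
Qed.

Ltac comp_more ::=
  lazymatch goal with
  | |- Comp (fun z => npair _ _) => refine (Comp_npair _ _)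
  | |- Comp (fun z => nfst _) => refine (Comp_nfst _)
  | |- Comp (fun z => nsnd _) => refine (Comp_nsnd _)
  | |- Comp (fun z => lcons _ _) => refine (Comp_lcons _ _)
  | |- Comp (fun z => nhead _) => refine (Comp_nhead _)
  | |- Comp (fun z => ntail _) => refine (Comp_ntail _)
  | |- Comp (fun z => nnth _ _) => refine (Comp_nnth _ _)
  | |- Comp (fun z => ncode (mkseq _ _)) => refine (Comp_mkseq _ _)
  end.

(** * Certificates and clocks *)

Definition triple (c v y : nat) : nat := npair c (npair v y).

(* [D] is a set of triples (program, arguments, value), and the disjuncts are the rules of
   [eval]; tags 6 and 7 are for lists of programs, whose values are coded lists.  All witnesses
   are bounded by [b]. *)
Definition justified (b : nat) (D : pred nat) (c v y : nat) : bool :=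
  let f := nfst (nsnd c) in let g := nsnd (nsnd c) in
  [|| (nfst c == 0) && (y == 0),
      [&& nfst c == 1, 0 < v & y == (nhead v).+1],
      (nfst c == 2) && (y == nnth v (nsnd c)),
      (nfst c == 3) && has (fun w => D (triple g v w) && D (triple f w y)) (iota 0 b),
      [&& nfst c == 4, 0 < v, nhead v == 0 & D (triple f (ntail v) y)],
      [&& nfst c == 4, 0 < v, 0 < nhead v &
         has (fun w => D (triple c (lcons (nhead v).-1 (ntail v)) w) &&
                       D (triple g (lcons (nhead v).-1 (lcons w (ntail v))) y)) (iota 0 b)],
      [&& nfst c == 5, D (triple (nsnd c) (lcons y v) 0) &
         all (fun m => has (fun k => D (triple (nsnd c) (lcons m v) k.+1)) (iota 0 b))
             (iota 0 y)],
      (nfst c == 6) && (y == 0) |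
      [&& nfst c == 7, y == lcons (nhead y) (ntail y),
          D (triple f v (nhead y)) & D (triple g v (ntail y))]].

(** The first component of [z] is the number of entries, which makes membership a bounded search
    through the list in the second. *)
Definition mem_code (z J : nat) : bool :=
  has (fun k => nnth (nsnd z) k == J) (iota 0 (nfst z)).

(* [z] codes a finite set of triples, each justified by others in the set.  No well-foundedness
   is asked for: [closed_uniq] argues along a genuine derivation instead. *)
Definition certificate (e a z : nat) : bool :=
  all (fun k => justified z (mem_code z) (nfst (nnth (nsnd z) k))
       (nfst (nsnd (nnth (nsnd z) k))) (nsnd (nsnd (nnth (nsnd z) k))))
    (iota 0 (nfst z)) &&
  has (fun y => mem_code z (triple e (lcons a 0) y)) (iota 0 z.+1).

Lemma Comp_mem_code (A : Type) (EA : Env A) (f g : A -> nat) : 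
  Comp f -> Comp g -> Comp (fun a => nat_of_bool (mem_code (f a) (g a))).
Proof.
apply: (Comp_app2 (k := fun x y => mem_code x y)); rewrite /mem_code; comp.
Qed.


Lemma Comp_justified (A : Type) (EA : Env A) (f g : A -> nat) :
  Comp f -> Comp g ->
  Comp (fun a => nat_of_bool (justified (f a) (mem_code (f a)) (nfst (g a)) (nfst (nsnd (g a)))
    (nsnd (nsnd (g a))))).
Proof.
apply: (Comp_app2 (k := fun x J =>
  justified x (mem_code x) (nfst J) (nfst (nsnd J)) (nsnd (nsnd J)))).
rewrite /justified /triple; cbv zeta.
repeat (cbv beta; first [comp_step | refine (Comp_mem_code _ _)]).
Qed.

Lemma Comp_certificate :
  Comp (fun z : unit * nat * nat * nat => nat_of_bool (certificate z.1.1.2 z.1.2 z.2)).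
Proof.
rewrite /certificate /triple; apply: Comp_andb.
  by apply: Comp_all; [comp | apply: Comp_justified; comp].
by apply: Comp_has; [comp | apply: Comp_mem_code; comp].
Qed.

(* Keeps conversion from evaluating codes in unary. *)
#[global] Opaque npair nfst nsnd lcons nhead ntail nnth.

(** * Soundness and completeness of certificates *)

Section EvalInd.
Variables (P : prf -> seq nat -> nat -> Prop) (Q : list prf -> seq nat -> seq nat -> Prop).
Hypotheses
  (Pzero : forall v, P PZero v 0)
  (Psucc : forall x v, P PSucc (x :: v) x.+1)
  (Pproj : forall i v, P (PProj i) v (nth 0 v i))
  (Pcomp : forall f gs v ys y, Q gs v ys -> P f ys y -> P (PComp f gs) v y)
  (Pprim0 : forall f g v y, P f v y -> P (PPrim f g) (0 :: v) y)
  (PprimS : forall f g n v y z, P (PPrim f g) (n :: v) y -> P g (n :: y :: v) z ->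
     P (PPrim f g) (n.+1 :: v) z)
  (Pmu : forall f v n, P f (n :: v) 0 ->
     (forall m, m < n -> exists k, P f (m :: v) k.+1) -> P (PMu f) v n)
  (Qnil : forall v, Q nil v [::])
  (Qcons : forall g gs v y ys, P g v y -> Q gs v ys -> Q (g :: gs) v (y :: ys)).

(* The generated scheme has no induction hypothesis below the existential of [ev_mu]. *)
Fixpoint eval_mu_ind p v y (E : eval p v y) {struct E} : P p v y :=
  match E in eval p v y return P p v y with
  | ev_zero v => Pzero v
  | ev_succ x v => Psucc x v
  | ev_proj i v => Pproj i v
  | ev_comp f gs v ys y Es E => Pcomp (evals_mu_ind Es) (eval_mu_ind E)
  | ev_prim0 f g v y E => Pprim0 g (eval_mu_ind E)
  | ev_primS f g n v y z E1 E2 => PprimS (eval_mu_ind E1) (eval_mu_ind E2)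
  | ev_mu f v n E0 Em => Pmu (eval_mu_ind E0) (fun m lt_mn =>
      match Em m lt_mn with ex_intro k Ek => ex_intro _ k (eval_mu_ind Ek) end)
  end
with evals_mu_ind gs v ys (E : evals gs v ys) {struct E} : Q gs v ys :=
  match E in evals gs v ys return Q gs v ys with
  | evs_nil v => Qnil v
  | evs_cons g gs v y ys E Es => Qcons (eval_mu_ind E) (evals_mu_ind Es)
  end.
End EvalInd.

Fixpoint prf_code (p : prf) : nat :=
  match p with
  | PZero => npair 0 0
  | PSucc => npair 1 0
  | PProj i => npair 2 i
  | PComp f gs => npair 3 (npair (prf_code f)
      ((fix codes gs := if gs is g :: gs' then npair 7 (npair (prf_code g) (codes gs'))
                        else npair 6 0) gs))
  | PPrim f g => npair 4 (npair (prf_code f) (prf_code g))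
  | PMu f => npair 5 (prf_code f)
  end.

(** A name for the fixpoint nested in [prf_code], needed to state the induction for lists of
    programs. *)
Fixpoint prfs_code (gs : list prf) : nat :=
  if gs is g :: gs' then npair 7 (npair (prf_code g) (prfs_code gs')) else npair 6 0.

Definition closed_under (b : nat) (D : pred nat) : Prop :=
  forall J, D J -> justified b D (nfst J) (nfst (nsnd J)) (nsnd (nsnd J)).

(** By induction on the derivation: the tag and, for tag 4, the first argument leave only one rule
    that can justify the triple, and its premises lie in [D] again. *)
Lemma closed_uniq b D p v y' : closed_under b D -> eval p v y' ->
  forall y, D (triple (prf_code p) (ncode v) y) -> y = y'.
Proof.
move=> clD; move: p v y'.
apply: (eval_mu_ind (Q := fun gs v ys => forall y,
  D (triple (prfs_code gs) (ncode v) y) -> y = ncode ys)); rewrite /=.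
- by move=> v y /clD; rewrite /justified !npairE /= ?orbF => /eqP.
- move=> x v y /clD; rewrite /justified !npairE /= !lconsE ?orbF => /eqP//.
- by move=> i v y /clD; rewrite /justified !npairE /= ?orbF nnth_ncode => /eqP.
- move=> f gs v ys y IHs IH y0; rewrite -/prfs_code => /clD.
  rewrite /justified !npairE /= ?orbF => /hasP[w _ /andP[/IHs-> /IH]] //.
- move=> f g v y IH y0 /clD.
  by rewrite /justified !npairE /= !lconsE /= ?orbF => /IH.
- move=> f g n v y z IH1 IH2 y0 /clD.
  rewrite /justified !npairE /= !lconsE /= ?orbF => /hasP[w _ /andP[/IH1-> /IH2]] //.
- move=> f v n IH0 IHm y0 /clD; rewrite /justified !npairE /= ?orbF => /andP[D0 Dm].
  (* A search ending before [n] would need the value [0] where [f] is positive; one ending after [n]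
     would need a positive value at [n]. *)
  case: (ltngtP y0 n) => // [lt_yn|lt_ny].
    by have [k /(_ _ D0)] := IHm _ lt_yn.
  move/allP/(_ n): Dm; rewrite mem_iota => /(_ lt_ny)/hasP[k _].
  by move/IH0.
- by move=> v y /clD; rewrite /justified !npairE /= ?orbF => /eqP.
- move=> g gs v y ys IH IHs y0 /clD; rewrite /justified !npairE /= ?orbF.
  by move=> /and3P[/eqP E /IH <- /IHs <-].
Qed.

(** The bound will be the code of the final set, unknown while the set is being built; hence every
    bound above all members is allowed. *)
Definition closed_seq (D : seq nat) : Prop :=
  forall b, all (fun J => J < b) D -> closed_under b (mem D).

(** [D] occurs only positively in [justified]. *)
Lemma justified_mono b (D D' : pred nat) c v y :
  (forall J, D J -> D' J) -> justified b D c v y -> justified b D' c v y.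
Proof.
move=> sD.
have orS (p p' q q' : bool) : (p -> p') -> (q -> q') -> p || q -> p' || q'.
  by case: p => [-> //| _ h /h ->]; rewrite orbT.
have andS (p q q' : bool) : (q -> q') -> p && q -> p && q' by case: p.
have and2S (p p' q q' : bool) : (p -> p') -> (q -> q') -> p && q -> p' && q'.
  by case: p => // -> // h /h ->.
rewrite /justified; do ?apply: (@orS) => //; do ?apply: (@andS).
- by apply: sub_has => w; apply: (@and2S); apply: (@sD).
- exact: (@sD).
- by apply: sub_has => w; apply: (@and2S); apply: (@sD).
- apply: (@and2S); first exact: (@sD).
  by apply: sub_all => m; apply: sub_has => k; apply: (@sD).
- by apply: (@and2S); apply: (@sD).
Qed.

Lemma closed_seq_cat D1 D2 : closed_seq D1 -> closed_seq D2 -> closed_seq (D1 ++ D2).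
Proof.
move=> C1 C2 b; rewrite all_cat => /andP[/C1 C1b /C2 C2b] J /=.
rewrite mem_cat => /orP[/C1b|/C2b]; apply: justified_mono => J' /= HJ;
  by rewrite mem_cat HJ ?orbT.
Qed.

Lemma closed_seq_add D c v y : closed_seq D ->
  (forall b, all (fun J => J < b) D -> justified b (mem D) c v y) ->
  exists2 D', closed_seq D' & triple c v y \in D'.
Proof.
move=> C H; exists (triple c v y :: D); last exact: mem_head.
move=> b /= /andP[_ B] J /=; have sub J' : J' \in D -> J' \in triple c v y :: D.
  by move=> HJ; rewrite in_cons HJ orbT.
rewrite in_cons => /orP[/eqP->|/(C _ B)]; last exact: justified_mono.
by rewrite !npairE; apply: justified_mono (H _ B).
Qed.

Lemma mem_triple_lt (D : seq nat) b c v y :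
  all (fun J => J < b) D -> triple c v y \in D -> y < b.
Proof.
move=> /allP B /B; apply: leq_ltn_trans.
exact: leq_trans (leq_npairr v y) (leq_npairr c _).
Qed.

Lemma closed_seq_exists p v y : eval p v y ->
  exists2 D, closed_seq D & triple (prf_code p) (ncode v) y \in D.
Proof.
move: p v y.
apply: (eval_mu_ind (Q := fun gs v ys =>
  exists2 D, closed_seq D & triple (prfs_code gs) (ncode v) (ncode ys) \in D)); rewrite /=.
- move=> v; apply: (@closed_seq_add [::]); first by [].
  by move=> b _; rewrite /justified !npairE.
- move=> x v; apply: (@closed_seq_add [::]); first by [].
  by move=> b _; rewrite /justified !npairE /= !lconsE eqxx.
- move=> i v; apply: (@closed_seq_add [::]); first by [].
  by move=> b _; rewrite /justified !npairE /= nnth_ncode eqxx.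
- move=> f gs v ys y [D1 C1 M1] [D2 C2 M2]; rewrite -/prfs_code.
  apply: closed_seq_add (closed_seq_cat C1 C2) _ => b; rewrite all_cat => /andP[B1 B2].
  rewrite /justified !npairE /= orbF; apply/hasP; exists (ncode ys).
    by rewrite mem_iota; exact: mem_triple_lt M1.
  by rewrite !mem_cat M1 M2 orbT.
- move=> f g v y [D1 C1 M1]; apply: closed_seq_add C1 _ => b B1.
  by rewrite /justified !npairE /= !lconsE /= M1.
- move=> f g n v y z [D1 C1 M1] [D2 C2 M2].
  apply: closed_seq_add (closed_seq_cat C1 C2) _ => b; rewrite all_cat => /andP[B1 B2].
  rewrite /justified !npairE /= !lconsE /= orbF; apply/hasP; exists y.
    by rewrite mem_iota; exact: mem_triple_lt M1.
  by rewrite !mem_cat M1 M2 orbT.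
- move=> f v n [D1 C1 M1] IH.
  (* The sequences for the single [m < n] are merged into one by induction on [n]. *)
  suff [D2 C2 M2] : exists2 D, closed_seq D & forall m, m < n ->
      exists k, triple (prf_code f) (lcons m (ncode v)) k.+1 \in D.
    apply: closed_seq_add (closed_seq_cat C1 C2) _ => b; rewrite all_cat => /andP[B1 B2].
    rewrite /justified !npairE /= !orbF mem_cat M1 /=; apply/allP => m; rewrite mem_iota.
    move=> /M2[k Mk]; apply/hasP; exists k; last by rewrite mem_cat Mk orbT.
    by rewrite mem_iota; exact: ltnW (mem_triple_lt B2 Mk).
  elim: n IH {M1} => [|n IHn] IH; first by exists [::].
  have [|D2 C2 M2] := IHn; first by move=> m lt_mn; apply: IH; apply: ltnW.
  have [//|k [D3 C3 M3]] := IH n.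
  exists (D2 ++ D3); first exact: closed_seq_cat.
  move=> m; rewrite ltnS leq_eqVlt => /orP[/eqP->|/M2[l Ml]].
    by exists k; rewrite mem_cat M3 orbT.
  by exists l; rewrite mem_cat Ml.
- move=> v; apply: (@closed_seq_add [::]); first by [].
  by move=> b _; rewrite /justified !npairE.
- move=> g gs v y ys [D1 C1 M1] [D2 C2 M2].
  apply: closed_seq_add (closed_seq_cat C1 C2) _ => b; rewrite all_cat => /andP[B1 B2].
  by rewrite /justified !npairE /= !lconsE /= eqxx !mem_cat M1 M2 orbT.
Qed.

(** A certificate bounds the value that it certifies. This is what makes a clock slower than the
    function it runs. *)
Lemma certificate_sound p a y z :
  eval p [:: a] y -> certificate (prf_code p) a z -> y <= z.
Proof.
move=> E /andP[/allP cl /hasP[y']]; rewrite mem_iota => lt_yz My.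
suff <- : y' = y by [].
apply: (closed_uniq (b := z) (D := mem_code z) _ E) My => J /hasP[k Hk /eqP Ek].
by have := cl _ Hk; rewrite Ek.
Qed.

Lemma certificate_complete p a y :
  eval p [:: a] y -> exists z, certificate (prf_code p) a z.
Proof.
move=> /closed_seq_exists[D C M].
set z := npair (size D) (ncode D).
have memz J : mem_code z J = (J \in D).
  rewrite /mem_code !npairE; apply/hasP/idP => [[k]|/(nthP 0)[k kD <-]].
    by rewrite mem_iota nnth_ncode => kD /eqP <-; apply: mem_nth.
  by exists k; rewrite ?mem_iota ?nnth_ncode.
have Bz : all (fun J => J < z) D.
  by apply/allP => J /ltn_ncode JD; apply: leq_trans JD (leq_npairr _ _).
exists z; apply/andP; split; last first.
  apply/hasP; exists y; last by rewrite memz.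
  by rewrite mem_iota; exact: leqW (mem_triple_lt Bz M).
apply/allP => k; rewrite mem_iota !npairE nnth_ncode => /= kD.
apply: justified_mono (C _ Bz _ (mem_nth 0 kD)) => J; by rewrite memz.
Qed.

(** The clock reads [a] while a certificate for the argument [a] is sought below the current stage.
    It moves by at most one per stage and stops for ever at the first argument without a
    certificate. *)
Fixpoint clock (e t : nat) : nat :=
  if t is t'.+1 then
    clock e t' + has (certificate e (clock e t')) (iota 0 t)
  else 0.

Lemma clockS e t :
  clock e t.+1 = clock e t + has (certificate e (clock e t)) (iota 0 t.+1).
Proof. by []. Qed.

Lemma Comp_clock (A : Type) (EA : Env A) (f g : A -> nat) :
  Comp f -> Comp g -> Comp (fun a => clock (f a) (g a)).
Proof.
move=> Cf Cg.
apply: (Comp_rec (F := fun a => clock (f a)) (b := fun=> 0)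
  (s := fun a k y => y + has (certificate (f a) y) (iota 0 k.+1))) => //; first by comp.
have := Comp_weak (Comp_weak Cf) => Cf2.
apply: Comp_add; first by comp.
apply: Comp_has; first by comp.
apply: (Comp_app3 (k := fun x y z => nat_of_bool (certificate x y z)) Comp_certificate); comp.
exact: (Comp_weak Cf2).
Qed.

Lemma clock_le e t t' : t <= t' -> clock e t <= clock e t'.
Proof.
move=> /subnK <-; elim: (t' - t) => // n IH.
by rewrite addSn; apply: leq_trans IH (leq_addr _ _).
Qed.

Lemma clock_certificate e t a : a < clock e t -> exists2 z, z < t & certificate e a z.
Proof.
elim: t => // t IH.
rewrite clockS => lt_a.
have [/IH[z zt cz]|le_a] := ltnP a (clock e t); first by exists z => //; apply: ltnW.
move: lt_a; case: hasP => [[z Hz cz] lt_a|]; last by rewrite addn0 ltnNge le_a.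
have -> : a = clock e t.
  by apply/eqP; rewrite eqn_leq le_a andbT -ltnS; rewrite addn1 in lt_a.
by exists z => //; move: Hz; rewrite mem_iota.
Qed.

Lemma clock_total (g : nat -> nat) : computable_nat g ->
  exists e, (forall n, exists t, n < clock e t) /\ (forall t a, a < clock e t -> g a < t).
Proof.
move=> [p Hp]; exists (prf_code p); split=> [n|t a /clock_certificate[z zt cz]]; last first.
  exact: leq_ltn_trans (certificate_sound (Hp a) cz) zt.
have step t : exists t', clock (prf_code p) t < clock (prf_code p) t'.
  have [z cz] := certificate_complete (Hp (clock (prf_code p) t)).
  (* Either the clock has moved by stage [t1], or it still waits for the same argument and meets [z]
     one stage later. *)
  pose t1 := maxn t z.
  have [lt_tt1|le_t1t] := ltnP (clock (prf_code p) t) (clock (prf_code p) t1); first by exists t1.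
  have eq_t : clock (prf_code p) t1 = clock (prf_code p) t.
    by apply/eqP; rewrite eqn_leq le_t1t clock_le ?leq_maxl.
  exists t1.+1; rewrite clockS eq_t (_ : has _ _ = true) ?addn1 //.
  by apply/hasP; exists z => //; rewrite mem_iota add0n ltnS /t1 leq_maxr.
elim: n => [|n [t lt_nt]]; first by have [t Ht] := step 0; exists t.
by have [t' Ht'] := step t; exists t'; apply: leq_trans Ht'; exact: lt_nt.
Qed.

(** * Requests *)

(* A state codes the stage after the last firing and, for each loop [e <= i+1], the number
   [cnt] of steps left after the current one and the denominator [den] of the step size.  The
   outermost loop [i+1] has a single step, the request as a whole. *)
Definition last_fired (st : nat) : nat := nfst st.
Definition cnt (st e : nat) : nat := nfst (nnth (nsnd st) e).
Definition den (st e : nat) : nat := nsnd (nnth (nsnd st) e).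

(** The innermost loop with a step left, as in an odometer; the value [i.+2] means that the request
    is completely filled. *)
Definition carry (i st : nat) : nat := find (fun e => 0 < cnt st e) (iota 0 i.+2).

Definition ready (i j t st : nat) : bool :=
  [&& carry i st < i.+2, j < clock i t &
    all (fun e => [|| carry i st < e, clock e t <= i + j | last_fired st < clock e t])
      (iota 0 i.+1)].

(** One step of the carry loop is split into [t.+1] steps of the next inner loop, the first of these
    again, and so on down to loop [0], where one step is filled. The current step is not counted,
    whence the count [t]. *)
Definition fire (i t st : nat) : nat :=
  npair t.+1 (ncode (mkseq (fun e =>
    if e < carry i st then npair t (den st (carry i st) * t.+1 ^ (carry i st - e))
    else if e == carry i st then npair (cnt st (carry i st)).-1 (den st (carry i st))
    else nnth (nsnd st) e) i.+2)).

Definition init_state (i : nat) : nat :=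
  npair 0 (ncode (mkseq (fun e => npair (e == i.+1) 1) i.+2)).

Fixpoint state (i j t : nat) : nat :=
  if t is t'.+1 then
    if ready i j t' (state i j t') then fire i t' (state i j t') else state i j t'
  else init_state i.

Lemma nfst0 : nfst 0 = 0.
Proof. by []. Qed.

Lemma carry_cnt i st : carry i st < i.+2 -> 0 < cnt st (carry i st).
Proof.
move=> lt_c; have := @nth_find _ 0 (fun e => 0 < cnt st e) (iota 0 i.+2).
by rewrite has_find size_iota => /(_ lt_c); rewrite nth_iota // add0n.
Qed.

Lemma carry_min i st e : e < carry i st -> cnt st e = 0.
Proof.
move=> lt_e; have := @before_find _ 0 (fun e => 0 < cnt st e) (iota 0 i.+2) e lt_e.
have lt_e2 : e < i.+2.
  apply: leq_trans lt_e _.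
  by have := find_size (fun e => 0 < cnt st e) (iota 0 i.+2); rewrite size_iota.
by rewrite nth_iota // add0n lt0n => /negbFE/eqP.
Qed.

Lemma carry_eq i st e : e < i.+2 -> 0 < cnt st e -> (forall e', e' < e -> cnt st e' = 0) ->
  carry i st = e.
Proof.
move=> lt_e cnt_e z_e; apply/eqP; rewrite eqn_leq; apply/andP; split.
  by rewrite leqNgt; apply/negP => /carry_min E; rewrite E in cnt_e.
rewrite leqNgt; apply/negP => lt_c.
by have := carry_cnt (ltn_trans lt_c lt_e); rewrite z_e.
Qed.

Section Fire.
Variables (i t st : nat).
Local Notation c := (carry i st).

Lemma last_fire : last_fired (fire i t st) = t.+1.
Proof. exact: nfst_npair. Qed.

Lemma nnth_fire e : e < i.+2 -> nnth (nsnd (fire i t st)) e =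
  if e < c then npair t (den st c * t.+1 ^ (c - e))
  else if e == c then npair (cnt st c).-1 (den st c) else nnth (nsnd st) e.
Proof. by move=> lt_e; rewrite /fire nsnd_npair nnth_ncode nth_mkseq. Qed.

Lemma cnt_fire e : e < i.+2 -> cnt (fire i t st) e =
  if e < c then t else if e == c then (cnt st c).-1 else cnt st e.
Proof.
move=> lt_e; rewrite {1}/cnt nnth_fire //.
by case: ifP => _; rewrite ?nfst_npair //; case: ifP => _; rewrite ?nfst_npair.
Qed.

Lemma den_fire e : e < i.+2 -> den (fire i t st) e =
  if e < c then den st c * t.+1 ^ (c - e) else den st e.
Proof.
move=> lt_e; rewrite {1}/den nnth_fire //.
case: ifP => _; rewrite ?nsnd_npair //; case: eqP => [->|//]; by rewrite ?nsnd_npair.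
Qed.

Lemma cnt_fire_out e : i.+2 <= e -> cnt (fire i t st) e = 0.
Proof.
by move=> ge_e; rewrite /cnt /fire nsnd_npair nnth_ncode nth_default ?size_mkseq // nfst0.
Qed.
End Fire.

Lemma cnt_init i e : cnt (init_state i) e = (e == i.+1).
Proof.
rewrite /cnt /init_state nsnd_npair nnth_ncode.
have [lt_e|ge_e] := ltnP e i.+2; first by rewrite nth_mkseq // nfst_npair.
by rewrite nth_default ?size_mkseq // nfst0; case: eqP => // E; rewrite E ltnn in ge_e.
Qed.

Lemma den_init i e : e < i.+2 -> den (init_state i) e = 1.
Proof. by move=> lt_e; rewrite /den /init_state nsnd_npair nnth_ncode nth_mkseq // nsnd_npair. Qed.

Lemma cnt_state_out i j t e : i.+2 <= e -> cnt (state i j t) e = 0.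
Proof.
move=> ge_e; elim: t => [|t IH] /=.
  by rewrite cnt_init; case: eqP => // E; rewrite E ltnn in ge_e.
by case: ifP => // _; rewrite cnt_fire_out.
Qed.

(** * The unfilled part of a request *)

Local Open Scope ring_scope.

Definition rem_below (st n : nat) : rat := \sum_(e < n) (cnt st e)%:R / (den st e)%:R.
Definition remaining (i st : nat) : rat := rem_below st i.+2.
(** The size of a step of loop [0] after the firing, which is the amount filled by it. *)
Definition piece (i t st : nat) : rat :=
  ((den st (carry i st))%:R * t.+1%:R ^+ carry i st)^-1.

Lemma rem_belowS st n : rem_below st n.+1 = rem_below st n + (cnt st n)%:R / (den st n)%:R.
Proof. by rewrite /rem_below big_ord_recr. Qed.

Lemma rem_below0 st n : (forall e, (e < n)%N -> cnt st e = 0%N) -> rem_below st n = 0.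
Proof. by move=> z; rewrite /rem_below big1 // => e _; rewrite z // mul0r. Qed.

Lemma rem_below_ge0 st n : 0 <= rem_below st n.
Proof. by apply: sumr_ge0 => e _; rewrite divr_ge0. Qed.

(** A reset loop has [t] of the [t.+1] parts of a step of the next outer loop left, so the sum
    telescopes. *)
Lemma rem_below_fire_low i t st n : (carry i st < i.+2)%N -> (0 < den st (carry i st))%N ->
  (n <= carry i st)%N ->
  rem_below (fire i t st) n =
    ((den st (carry i st))%:R * t.+1%:R ^+ (carry i st - n))^-1 - piece i t st.
Proof.
move=> lt_c den_gt0; elim: n => [|n IH] le_n.
  by rewrite /piece subn0 subrr /rem_below big_ord0.
have lt_n2 : (n < i.+2)%N by apply: ltn_trans lt_c.
rewrite rem_belowS IH ?(ltnW le_n) // cnt_fire // den_fire // le_n.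
rewrite natrM natrX -(subnSK le_n) exprS.
rewrite addrAC; congr (_ - _).
have : (den st (carry i st))%:R != 0 :> rat by rewrite pnatr_eq0 -lt0n.
have : t.+1%:R != 0 :> rat by rewrite pnatr_eq0.
rewrite -[t.+1]addn1 natrD; set T := t%:R; set X := _ ^+ _ => T0 D0.
have X0 : X != 0 by rewrite /X expf_neq0.
by field; rewrite D0 T0 X0.
Qed.

(** The carry loop gives up one step, and the loops inside take all of it back except for one
    piece. *)
Lemma rem_below_fire_high i t st n : (0 < den st (carry i st))%N ->
  (carry i st < n)%N -> (n <= i.+2)%N -> rem_below (fire i t st) n = rem_below st n - piece i t st.
Proof.
move=> den_gt0; elim: n => // n IH; rewrite ltnS leq_eqVlt => /orP[/eqP E|lt_c] lt_n.
  have lt_c2 : (carry i st < i.+2)%N by rewrite E.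
  rewrite -E !rem_belowS rem_below_fire_low // subnn expr0 mulr1.
  rewrite [rem_below st _]rem_below0; last exact: carry_min.
  rewrite cnt_fire ?den_fire // !ltnn eqxx.
  have : (cnt st (carry i st))%:R = ((cnt st (carry i st)).-1)%:R + 1 :> rat.
    by rewrite natr1 prednK // carry_cnt.
  by move=> ->; lra.
rewrite !rem_belowS IH ?(ltnW lt_n) // cnt_fire ?den_fire // ltnNge (ltnW lt_c) /=.
by rewrite (gtn_eqF lt_c) addrAC.
Qed.

(** The loops inside loop [e] only subdivide its current step, so they have at most the size of that
    step left. *)
Definition wf_state (i st : nat) : Prop :=
  (forall e, (e < i.+2)%N -> (0 < den st e)%N /\ rem_below st e <= (den st e)%:R^-1) /\
  remaining i st <= 1.

Lemma piece_gt0 i t st : (0 < den st (carry i st))%N -> 0 < piece i t st.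
Proof. by move=> d0; rewrite invr_gt0 mulr_gt0 ?exprn_gt0 ?ltr0n. Qed.

Lemma wf_fire i t st : (carry i st < i.+2)%N -> wf_state i st -> wf_state i (fire i t st).
Proof.
move=> lt_c [wf rem1]; have [d0 _] := wf _ lt_c.
split; last by rewrite /remaining rem_below_fire_high // lerBlDr ler_wpDr // ltW // piece_gt0.
move=> e lt_e; rewrite den_fire //; case: (ltnP e (carry i st)) => [lt_ec|le_ce].
  split; first by rewrite muln_gt0 d0 expn_gt0.
  by rewrite rem_below_fire_low ?(ltnW lt_ec) // natrM natrX lerBlDr lerDl ltW // piece_gt0.
have [de re] := wf _ lt_e; split=> //.
move: le_ce; rewrite leq_eqVlt => /orP[/eqP E|lt_ce]; last first.
  by rewrite rem_below_fire_high ?(ltnW lt_e) // lerBlDr ler_wpDr // ltW // piece_gt0.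
by rewrite -E rem_below_fire_low // subnn expr0 mulr1 lerBlDr lerDl ltW // piece_gt0.
Qed.

Lemma wf_init i : wf_state i (init_state i).
Proof.
have z e : (e < i.+2)%N -> rem_below (init_state i) e = 0.
  by move=> lt_e; apply: rem_below0 => e' lt_e'; rewrite cnt_init; case: eqP => // E; lia.
split=> [e lt_e|]; first by rewrite den_init // z.
by rewrite /remaining rem_belowS z // cnt_init den_init // eqxx divr1 add0r.
Qed.

Lemma wf_stateP i j t : wf_state i (state i j t).
Proof.
elim: t => [|t IH] /=; first exact: wf_init.
by case: ifP => // /and3P[lt_c _ _]; apply: wf_fire.
Qed.

Lemma remaining_fire i t st : (carry i st < i.+2)%N -> wf_state i st ->
  remaining i (fire i t st) = remaining i st - piece i t st.
Proof. by move=> lt_c [/(_ _ lt_c)[d0 _] _]; rewrite /remaining rem_below_fire_high. Qed.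

Definition filled (i j t : nat) : rat := 1 - remaining i (state i j t).

Lemma filled_ge0 i j t : 0 <= filled i j t.
Proof. by rewrite subr_ge0; have [] := wf_stateP i j t. Qed.

Lemma filled_le1 i j t : filled i j t <= 1.
Proof. by rewrite lerBlDr lerDl rem_below_ge0. Qed.

Lemma filled_le i j t t' : (t <= t')%N -> filled i j t <= filled i j t'.
Proof.
move=> /subnK <-; elim: (t' - t)%N => // n IH; apply: le_trans IH _.
rewrite addSn /filled /=; case: ifP => // /and3P[lt_c _ _].
have wf := wf_stateP i j (n + t); rewrite remaining_fire //.
by rewrite lerD2l lerN2 lerBlDr lerDl ltW // piece_gt0 //; have [/(_ _ lt_c)[]] := wf.
Qed.

Local Close Scope ring_scope.

(** * Progress and stabilisation of a single request *)

Lemma nonincreasing_stable (f : nat -> nat) t0 :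
  (forall t, t0 <= t -> f t.+1 <= f t) ->
  exists2 t1, t0 <= t1 & forall t, t1 <= t -> f t = f t1.
Proof.
have [n] := ubnP (f t0); elim: n t0 => // n IH t0; rewrite ltnS => le_fn dec.
have decS t : t0 <= t -> f t <= f t0.
  move=> /subnK <-; elim: (t - t0) => // m IHm; apply: leq_trans IHm.
  by rewrite addSn; apply: dec; rewrite leq_addl.
have [|] := pselect (forall t, t0 <= t -> f t = f t0); first by exists t0.
move=> /existsNP[t /not_implyP[le_t /eqP ne_f]].
have lt_f : f t < n by apply: leq_trans le_fn; rewrite ltn_neqAle ne_f decS.
have [t' le_t'|t1 le_t1 st] := IH t lt_f; first by apply: dec; apply: leq_trans le_t'.
by exists t1 => //; apply: leq_trans le_t1.
Qed.

Lemma eventually_all n (P : nat -> nat -> Prop) :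
  (forall k, k < n -> exists T, forall t, T <= t -> P k t) ->
  exists T, forall k, k < n -> forall t, T <= t -> P k t.
Proof.
elim: n => [|n IH] H; first by exists 0.
have [k lt_k|T1 H1] := IH; first by apply: H; apply: ltnW.
have [//|T2 H2] := H n.
exists (maxn T1 T2) => k; rewrite ltnS leq_eqVlt => /orP[/eqP->|lt_k] t;
  rewrite geq_max => /andP[? ?].
  exact: H2.
exact: H1.
Qed.

Section Request.
Variables i j : nat.
Local Notation st := (state i j).

Lemma stateS t :
  st t.+1 = if ready i j t (st t) then fire i t (st t) else st t.
Proof. by []. Qed.

Lemma state_const T t : (forall t, T <= t -> ~~ ready i j t (st T)) -> T <= t -> st t = st T.
Proof.
move=> nr /subnK <-; elim: (t - T) => // n IH; rewrite addSn /= IH.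
by rewrite (negbTE (nr _ _)) // leq_addl.
Qed.

Lemma state_unasked t : clock i t <= j -> st t = init_state i.
Proof.
elim: t => // t IH /= le_j.
have le_t : clock i t <= j := leq_trans (leq_addr _ _) le_j.
by rewrite IH // /ready (ltnNge j) le_t andbF.
Qed.

(* The loops below [n] are completed again and again. *)
Definition recurs_zero (n : nat) : Prop :=
  forall t, exists2 t', t <= t' & forall e, e < n -> cnt (st t') e = 0.

(** If loops [0] to [e] are not completed again and again, then the carry eventually stays at or
    below [e], loop [e] is no longer reset, and its count becomes constant. When the loops inside
    are next at zero, any firing would lower this count, so the state is frozen. *)
Lemma recurs_zero_or_stuck e : e < i.+2 -> recurs_zero e ->
  recurs_zero e.+1 \/
  exists T, (forall t, T <= t -> st t = st T) /\ carry i (st T) = e.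
Proof.
move=> lt_e Ze; have [|] := pselect (recurs_zero e.+1); first by left.
move=> /existsNP[t0 nZ]; right.
have {}nZ t : t0 <= t -> ~ forall e', e' <= e -> cnt (st t) e' = 0.
  by move=> le_t z; apply: nZ; exists t.
have carry_le t : t0 <= t -> carry i (st t) <= e.
  move=> /nZ; rewrite leqNgt => nz; apply/negP => lt_c; apply: nz => e' le_e.
  by apply: (@carry_min i); apply: leq_ltn_trans lt_c.
have [t1 le_t1 stable] : exists2 t1, t0 <= t1 &
    forall t, t1 <= t -> cnt (st t) e = cnt (st t1) e.
  apply: (nonincreasing_stable (f := fun t => cnt (st t) e)) => t /carry_le le_c /=.
  case: ifP => // _; rewrite cnt_fire // ltnNge le_c /=.
  by case: eqP => // ->; apply: leq_pred.
have [T le_T zT] := Ze t1; exists T.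
have cT : 0 < cnt (st T) e.
  rewrite lt0n; apply/eqP => z; apply: (nZ T (leq_trans le_t1 le_T)) => e'.
  by rewrite leq_eqVlt => /orP[/eqP->|/zT].
have cE : carry i (st T) = e by apply: carry_eq.
split=> // t; elim: t => [|t IH]; first by rewrite leqn0 => /eqP ->.
rewrite leq_eqVlt => /orP[/eqP <- //|]; rewrite ltnS => le_Tt.
have {}IH := IH le_Tt.
have := stable t.+1 (leq_trans le_T (leqW le_Tt)).
rewrite -(stable T le_T) /= IH; case: ifP => // _.
by rewrite cnt_fire // cE ltnn eqxx; lia.
Qed.

Lemma recurs_zero0 : recurs_zero 0.
Proof. by move=> t; exists t. Qed.

(** Going outwards through the loops, either one of them gets stuck or all counts vanish at once,
    and then the request is complete. *)
Lemma state_stabilizes : exists T, forall t, T <= t -> st t = st T.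
Proof.
suff : recurs_zero i.+2 \/ exists T, forall t, T <= t -> st t = st T.
  move=> [Z|//]; have [T _ zT] := Z 0; exists T => t; apply: state_const => t' _.
  apply/negP => /and3P[lt_c _ _]; have := carry_cnt lt_c.
  by rewrite zT.
have : i.+2 <= i.+2 by []; move: {1 3}i.+2 => n; elim: n => [|n IH] lt_n.
  by left; apply: recurs_zero0.
case: (IH (ltnW lt_n)) => [Z|]; last by right.
by case: (recurs_zero_or_stuck lt_n Z) => [|[T [HT _]]]; [left|right; exists T].
Qed.

(** A stuck loop [e < n] consults only clocks up to [e]; each of these is ignored or eventually
    exceeds the last firing, so the request would fire. *)
Lemma recurs_zero_progress n : n <= i.+2 -> (exists t, j < clock i t) ->
  (forall e, e < n -> e <= i ->
     (forall k, exists t, k < clock e t) \/ (forall t, clock e t <= i + j)) ->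
  recurs_zero n.
Proof.
move=> le_n [t0 asked]; elim: n le_n => [|n IH] lt_n total; first exact: recurs_zero0.
have /(recurs_zero_or_stuck lt_n)[//|[T [stT cT]]] : recurs_zero n.
  by apply: IH (ltnW lt_n) _ => e lt_e; apply: total; apply: ltnW.
have [T1 H1] : exists T1, forall e, e < i.+1 -> forall t, T1 <= t ->
    [|| carry i (st T) < e, clock e t <= i + j | last_fired (st T) < clock e t].
  apply: eventually_all => e; rewrite ltnS cT => le_e.
  have [lt_ne|le_en] := ltnP n e; first by exists 0.
  case: (total e _ le_e) => // [unb|bnd]; last by exists 0 => t _; rewrite bnd.
  have [T1 H1] := unb (last_fired (st T)); exists T1 => t le_t.
  by rewrite (leq_trans H1 (clock_le _ le_t)) orbT.
pose t := maxn T (maxn t0 T1).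
have le_Tt : T <= t by rewrite leq_maxl.
have le_t0 : t0 <= t by rewrite /t; lia.
have le_T1 : T1 <= t by rewrite /t; lia.
have rdy : ready i j t (st t).
  rewrite stT // /ready cT lt_n (leq_trans asked (clock_le _ le_t0)) !andTb.
  by apply/allP => e; rewrite mem_iota -cT => lt_e; exact: H1.
have := stT _ (leqW le_Tt); rewrite /= rdy stT // => E.
have := cnt_fire t (st T) lt_n; rewrite E cT ltnn eqxx.
by have := carry_cnt (i := i) (st := st T); rewrite cT => /(_ lt_n); lia.
Qed.

Lemma recurs_zero_unasked : (forall t, clock i t <= j) -> recurs_zero i.+1.
Proof.
move=> un t; exists t => // e lt_e; rewrite state_unasked // cnt_init.
by case: eqP => // E; rewrite E ltnn in lt_e.
Qed.

(* From now on, steps of loop [e] have size less than [1 / t1]. *)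
Definition fine_level (e t1 t : nat) : bool :=
  ((e <= i) && (t1 < den (st t) e)) || all (fun e' => cnt (st t) e' == 0) (iota 0 e.+1).

Lemma fine_level_zero e t1 t : (forall e', e' < e.+1 -> cnt (st t) e' = 0) -> fine_level e t1 t.
Proof.
by move=> z; apply/orP; right; apply/allP => e'; rewrite mem_iota => /z ->.
Qed.

Lemma den_fire_gt e t : carry i (st t) < i.+2 -> e < carry i (st t) ->
  t < den (fire i t (st t)) e.
Proof.
move=> lt_c lt_ec; rewrite den_fire ?lt_ec; last exact: ltn_trans lt_c.
have [/(_ _ lt_c)[d0 _] _] := wf_stateP i j t.
apply: leq_trans (leq_pmull _ d0); rewrite -(subnSK lt_ec) expnS.
by apply: leq_trans (leq_pmulr _ _); rewrite // expn_gt0.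
Qed.

(** A loop that is reset at a stage gets a denominator above that stage, and if the counts up to [e]
    all vanish, then the next firing resets loop [e]. *)
Lemma fine_level_le e t1 t t' : t1 <= t -> t <= t' -> fine_level e t1 t -> fine_level e t1 t'.
Proof.
move=> le_t1 /subnK <-; elim: (t' - t) => // n IH /IH; rewrite addSn /fine_level stateS.
have le_t1n : t1 <= n + t by apply: leq_trans le_t1 _; rewrite leq_addl.
case: ifP => // /and3P[lt_c _ _] /orP[/andP[le_e lt_d]|/allP z].
  apply/orP; left; rewrite le_e /=.
  have [lt_ec|le_ce] := ltnP e (carry i (st (n + t))).
    exact: leq_ltn_trans le_t1n (den_fire_gt lt_c lt_ec).
  by rewrite den_fire ?ltnNge ?le_ce //=; lia.
have lt_ec : e < carry i (st (n + t)).
  rewrite ltnNge; apply/negP => le_c; have := carry_cnt lt_c.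
  by have /z/eqP -> : carry i (st (n + t)) \in iota 0 e.+1 by rewrite mem_iota ltnS.
apply/orP; left; apply/andP; split; first by lia.
exact: leq_ltn_trans le_t1n (den_fire_gt lt_c lt_ec).
Qed.

(** Only the first firing in the interval can advance loop [e] or an outer one. All later firings
    stay within a single step of loop [e], which is small. *)
Lemma filled_delta e t t' t1 : e <= i -> t <= t' -> t1 <= t -> i + j < clock e t ->
  (forall a u, t < a -> u < t' -> clock e u <= a) -> fine_level e t1 t ->
  (filled i j t' - filled i j t <= t1.+1%:R^-1)%R.
Proof.
move=> le_e le_tt' le_t1 big sep gd.
have B0 : (0 <= t1.+1%:R^-1 :> rat)%R by rewrite invr_ge0.
have lt_e2 : e < i.+2 by lia.
have bound (d : nat) : t1 < d -> (d%:R^-1 <= t1.+1%:R^-1 :> rat)%R.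
  by move=> lt_d; rewrite lef_pV2 ?posrE ?ltr0n ?ler_nat //; apply: leq_ltn_trans lt_d.
move: (t1.+1%:R^-1)%R B0 bound => B B0 bound.
(* The invariant: either nothing has fired yet, or what has been filled since [t] plus what the
   loops inside [e] can still fill is at most [B]. *)
pose H u := (st u = st t) \/ [/\ t < last_fired (st u), t1 < den (st u) e &
  (remaining i (st t) - remaining i (st u) + rem_below (st u) e <= B)%R].
suff Hu u : t <= u -> u <= t' -> H u.
  have [E|[_ _ le_r]] := Hu t' le_tt' (leqnn _); first by rewrite /filled E subrr.
  have r0 := rem_below_ge0 (st t') e; rewrite /filled; lra.
move=> /subnK <-; elim: (u - t) => [|n IH] le_u; first by left.
have {}IH := IH (ltnW le_u).
set u' := n + t in IH le_u *; rewrite addSn -/u' /H stateS; case: ifP => // rdy.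
right; rewrite last_fire; have le_tu : t <= u' by rewrite leq_addl.
have /and3P[lt_c _ /allP wait] := rdy.
have wf := wf_stateP i j u'.
have [/(_ _ lt_c)[d0 _] _] := wf.
have p0 := piece_gt0 u' d0.
have step := remaining_fire u' lt_c wf.
have lt_ut : u' < t' by apply: leq_trans le_u; rewrite addSn.
(* Clock [e] is not ignored and does not exceed a firing stage of this interval before [t'], so it
   blocks loop [e] and all outer loops. *)
have ltc_new : t < last_fired (st u') -> carry i (st u') < e.
  move=> lt_t; rewrite ltnNge; apply/negP => le_c.
  have := wait e; rewrite mem_iota ltnS => /(_ le_e); rewrite ltnNge le_c /=.
  have -> : (clock e u' <= i + j) = false.
    by apply/negbTE; rewrite -ltnNge; apply: leq_trans big (clock_le _ le_tu).
  by rewrite ltnNge (sep _ _ lt_t lt_ut).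
have gd' : carry i (st u') <= e -> st u' = st t -> t1 < den (st u') e.
  move=> le_c E; rewrite E; case/orP: gd => [/andP[]//|/allP z].
  have /z/eqP : carry i (st u') \in iota 0 e.+1 by rewrite mem_iota ltnS.
  by have := carry_cnt lt_c; rewrite E => /[swap] ->.
have [lt_ce|le_ec] := ltnP (carry i (st u')) e.
  have lt_d : t1 < den (st u') e.
    by case: IH => [|[]//]; apply: gd'; apply: ltnW.
  rewrite den_fire // [_ < carry _ _]ltnNge (ltnW lt_ce); split => //.
  rewrite step rem_below_fire_high ?(ltnW lt_e2) //.
  case: IH => [E|[_ _ le_r]]; last by lra.
  have [/(_ _ lt_e2)[_ le_r] _] := wf.
  by have le_b := bound _ lt_d; rewrite -E; lra.
(* A firing with carry at least [e] must be the first one in the interval. *)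
have E : st u' = st t by case: IH => // -[/ltc_new]; rewrite ltnNge le_ec.
have denE : den (fire i u' (st u')) e =
    den (st u') (carry i (st u')) * u'.+1 ^ (carry i (st u') - e).
  rewrite den_fire //; case: ltnP => // le_ce.
  have -> : e = carry i (st u') by apply/eqP; rewrite eqn_leq le_ec le_ce.
  by rewrite subnn muln1.
have lt_d : t1 < den (fire i u' (st u')) e.
  have [lt_ec|le_ce] := ltnP e (carry i (st u')).
    exact: leq_ltn_trans (leq_trans le_t1 le_tu) (den_fire_gt lt_c lt_ec).
  by rewrite den_fire // (ltnNge e) le_ce; exact: gd'.
split=> //; rewrite step rem_below_fire_low //.
have := bound _ lt_d; rewrite denE natrM natrX -E.
by move: (_ ^-1)%R (piece _ _ _) (remaining _ _) => d p r le_d; lra.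
Qed.

Lemma filled_unasked t : clock i t <= j -> filled i j t = 0%R.
Proof.
move=> /state_unasked E; rewrite /filled E /remaining rem_belowS rem_below0.
  by rewrite cnt_init den_init // eqxx divr1 add0r subrr.
by move=> e lt_e; rewrite cnt_init ltn_eqF.
Qed.

Lemma filled_zero t : (forall e, e < i.+2 -> cnt (st t) e = 0) -> filled i j t = 1%R.
Proof. by move=> z; rewrite /filled /remaining rem_below0 ?subr0. Qed.
End Request.

(** * Computability of the states *)

Lemma Comp_cnt (A : Type) (EA : Env A) (f g : A -> nat) :
  Comp f -> Comp g -> Comp (fun a => cnt (f a) (g a)).
Proof. by move=> Cf Cg; rewrite /cnt; comp. Qed.

Lemma Comp_den (A : Type) (EA : Env A) (f g : A -> nat) :
  Comp f -> Comp g -> Comp (fun a => den (f a) (g a)).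
Proof. by move=> Cf Cg; rewrite /den; comp. Qed.

Lemma Comp_carry (A : Type) (EA : Env A) (f g : A -> nat) :
  Comp f -> Comp g -> Comp (fun a => carry (f a) (g a)).
Proof. by apply: (Comp_app2 (k := carry)); rewrite /carry /cnt; comp. Qed.

Ltac comp_more ::=
  lazymatch goal with
  | |- Comp (fun z => npair _ _) => refine (Comp_npair _ _)
  | |- Comp (fun z => nfst _) => refine (Comp_nfst _)
  | |- Comp (fun z => nsnd _) => refine (Comp_nsnd _)
  | |- Comp (fun z => nnth _ _) => refine (Comp_nnth _ _)
  | |- Comp (fun z => ncode (mkseq _ _)) => refine (Comp_mkseq _ _)
  | |- Comp (fun z => clock _ _) => refine (Comp_clock _ _)
  | |- Comp (fun z => cnt _ _) => refine (Comp_cnt _ _)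
  | |- Comp (fun z => den _ _) => refine (Comp_den _ _)
  | |- Comp (fun z => carry _ _) => refine (Comp_carry _ _)
  end.

Lemma Comp_state (A : Type) (EA : Env A) (f g h : A -> nat) :
  Comp f -> Comp g -> Comp h -> Comp (fun a => state (f a) (g a) (h a)).
Proof.
apply: Comp_app3.
apply: (Comp_rec (A := unit * nat * nat * nat) (F := fun z t => state z.1.1.2 z.1.2 t)
  (b := fun z => init_state z.1.1.2)
  (s := fun z t y => if ready z.1.1.2 z.1.2 t y then fire z.1.1.2 t y else y)
  (n := fun z => z.2)) => //.
- by rewrite /init_state; comp.
- by rewrite /ready /fire /last_fired; comp.
- by comp.
Qed.

Local Open Scope ring_scope.

(** * Computable sequences of rationals *)

Definition QComp (A : Type) {EA : Env A} (f : A -> rat) : Prop :=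
  exists a b c : A -> nat, [/\ Comp a, Comp b, Comp c &
    forall z, f z = ((a z)%:R - (b z)%:R) / (c z).+1%:R].

Section QClosure.
Context {A : Type} {EA : Env A}.
Implicit Types (f g : A -> rat) (n : A -> nat).

Lemma QComp_nat n : Comp n -> QComp (fun a => (n a)%:R).
Proof.
move=> Cn; exists n, (fun=> 0%N), (fun=> 0%N); split=> //; try exact: Comp_const.
by move=> z; rewrite subr0 divr1.
Qed.

Lemma QComp_inv n : Comp n -> QComp (fun a => (n a)%:R^-1).
Proof.
move=> Cn; exists (fun a => nat_of_bool (0 < n a)%N), (fun=> 0%N), (fun a => (n a).-1).
split; try by comp.
by move=> z; rewrite subr0; case: (n z) => [|k] /=; rewrite ?invr0 ?mul0r ?mul1r.
Qed.

Lemma QComp_sub f g : QComp f -> QComp g -> QComp (fun a => f a - g a).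
Proof.
move=> [a [b [c [Ca Cb Cc E]]]] [a' [b' [c' [Ca' Cb' Cc' E']]]].
exists (fun z => a z * (c' z).+1 + b' z * (c z).+1)%N,
  (fun z => b z * (c' z).+1 + a' z * (c z).+1)%N,
  (fun z => ((c z).+1 * (c' z).+1).-1)%N; split; try by comp.
move=> z; rewrite E E' prednK ?muln_gt0 // !natrD !natrM.
have : (c z).+1%:R != 0 :> rat by rewrite pnatr_eq0.
have : (c' z).+1%:R != 0 :> rat by rewrite pnatr_eq0.
move: (c z).+1%:R (c' z).+1%:R => u v v0 u0.
by field; rewrite u0 v0.
Qed.

Lemma QComp_mul f g : QComp f -> QComp g -> QComp (fun a => f a * g a).
Proof.
move=> [a [b [c [Ca Cb Cc E]]]] [a' [b' [c' [Ca' Cb' Cc' E']]]].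
exists (fun z => a z * a' z + b z * b' z)%N, (fun z => a z * b' z + b z * a' z)%N,
  (fun z => ((c z).+1 * (c' z).+1).-1)%N; split; try by comp.
move=> z; rewrite E E' prednK ?muln_gt0 // !natrD !natrM.
have : (c z).+1%:R != 0 :> rat by rewrite pnatr_eq0.
have : (c' z).+1%:R != 0 :> rat by rewrite pnatr_eq0.
move: (c z).+1%:R (c' z).+1%:R => u v v0 u0.
by field; rewrite u0 v0.
Qed.

Lemma Comp_ltq f g : QComp f -> QComp g -> Comp (fun a => nat_of_bool (f a < g a)).
Proof.
move=> [a [b [c [Ca Cb Cc E]]]] [a' [b' [c' [Ca' Cb' Cc' E']]]].
apply: (Comp_ext (g := fun z => nat_of_bool
  (a z * (c' z).+1 + b' z * (c z).+1 < a' z * (c z).+1 + b z * (c' z).+1)%N)); last by comp.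
move=> z; congr nat_of_bool; rewrite E E'.
rewrite ltr_pdivrMr ?ltr0n // mulrAC ltr_pdivlMr ?ltr0n //.
rewrite -(ltr_nat rat) !natrD !natrM !mulrBl.
by rewrite ltrBlDr addrAC ltrBrDr [X in _ = (_ < X)]addrC [X in (_ < X) = _]addrC.
Qed.
End QClosure.

Lemma QComp_sum (A : Type) (EA : Env A) (F : A -> nat -> rat) (n : A -> nat) :
  Comp n -> QComp (fun z : A * nat => F z.1 z.2) -> QComp (fun a => \sum_(i < n a) F a i).
Proof.
move=> Cn [a [b [c [Ca Cb Cc E]]]].
have pairE (f : A * nat -> nat) : Comp f -> Comp (fun z : A * nat => f (z.1, z.2)).
  by apply: Comp_ext => -[].
(* The product of all denominators is a common one; [num] updates the numerators by
   cross-multiplication. *)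
pose C x k := (\prod_(i < k) (c (x, val i)).+1)%N.
have C0 x k : (0 < C x k)%N by apply: prodn_gt0.
have CC : Comp (fun z : A * nat => C z.1 z.2).
  apply: (Comp_prod (A := A * nat) (F := fun z i => (c (z.1, i)).+1)) => //; first by comp.
  apply: Comp_succ; exact: (Comp_skip (F := fun x k => c (x, k)) (pairE _ Cc)).
pose num (f : A * nat -> nat) x :=
  nat_rec (fun=> nat) 0%N (fun k y => (y * (c (x, k)).+1 + f (x, k) * C x k)%N).
have Cnum f : Comp f -> Comp (fun x => num f x (n x)).
  move=> /pairE Cf; apply: (Comp_rec (F := num f)
    (s := fun x k y => (y * (c (x, k)).+1 + f (x, k) * C x k)%N)  _ _ (Comp_const 0)) => //.
  have := Comp_skip (F := fun x k => f (x, k)) Cf.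
  have := Comp_skip (F := fun x k => c (x, k)) (pairE _ Cc).
  by have := Comp_skip CC => ? ? ?; comp.
exists (fun x => num a x (n x)), (fun x => num b x (n x)), (fun x => (C x (n x)).-1).
split; [exact: Cnum | exact: Cnum | |].
  by apply: Comp_pred; exact: (Comp_subst CC Cn).
move=> x; rewrite prednK //; elim: (n x) => [|k IH]; first by rewrite big_ord0 subrr mul0r.
rewrite big_ord_recr /= IH (E (x, k)).
have -> : C x k.+1 = (C x k * (c (x, k)).+1)%N by rewrite /C big_ord_recr.
rewrite -/(num a x k) -/(num b x k) !natrD !natrM.
have : (c (x, k)).+1%:R != 0 :> rat by rewrite pnatr_eq0.
have : (C x k)%:R != 0 :> rat by rewrite pnatr_eq0 -lt0n.
move: (c _).+1%:R (C x k)%:R => u v v0 u0.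
by field; rewrite u0 v0.
Qed.

(** * The weighted sum over all requests *)

Definition xseq (t : nat) : rat :=
  \sum_(i < t) \sum_(j < t) (2 ^ (i + j))%:R^-1 * filled i j t.

Lemma QComp_xseq (A : Type) (EA : Env A) (n : A -> nat) :
  Comp n -> QComp (fun a => xseq (n a)).
Proof.
move=> Cn; rewrite /xseq.
apply: (QComp_sum (F := fun a i => \sum_(j < n a) (2 ^ (i + j))%:R^-1 * filled i j (n a))) => //.
have C1 := Comp_weak Cn.
apply: (QComp_sum (F := fun a j => (2 ^ (a.2 + j))%:R^-1 * filled a.2 j (n a.1))) => //.
have C2 := Comp_weak C1.
apply: QComp_mul; first by apply: QComp_inv; comp.
apply: QComp_sub; first by apply: (QComp_nat (n := fun=> 1%N)); comp.
have Cs : Comp (fun z : A * nat * nat => state z.1.2 z.2 (n z.1.1)) by apply: Comp_state; comp.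
rewrite /remaining /rem_below.
apply: (QComp_sum (F := fun z e => (cnt (state z.1.2 z.2 (n z.1.1)) e)%:R /
  (den (state z.1.2 z.2 (n z.1.1)) e)%:R)); first by comp.
have Cs' := Comp_weak Cs.
by apply: QComp_mul; [apply: QComp_nat | apply: QComp_inv]; comp.
Qed.

Definition weight (i j : nat) : rat := (2 ^ (i + j))%:R^-1.
Definition sum2 (K : nat) (a : nat -> nat -> rat) : rat := \sum_(i < K) \sum_(j < K) a i j.

Lemma weight_gt0 i j : 0 < weight i j.
Proof. by rewrite invr_gt0 ltr0n expn_gt0. Qed.

Lemma sum2_mono (a b : nat -> nat -> rat) K :
  (forall i j, (i < K)%N -> (j < K)%N -> a i j <= b i j) -> sum2 K a <= sum2 K b.
Proof. by move=> ab; apply: ler_sum => i _; apply: ler_sum => j _; apply: ab. Qed.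

Lemma sum2_le (a : nat -> nat -> rat) K L : (forall i j, 0 <= a i j) -> (K <= L)%N ->
  sum2 K a <= sum2 L a.
Proof.
move=> a0 /subnK <-; elim: (L - K)%N => // n IH; apply: le_trans IH _.
rewrite addSn /sum2 big_ord_recr /= ler_wpDr ?sumr_ge0 //.
by apply: ler_sum => i _; rewrite big_ord_recr /= lerDl.
Qed.

Lemma sum2B (a b : nat -> nat -> rat) K :
  sum2 K (fun i j => a i j - b i j) = sum2 K a - sum2 K b.
Proof. by rewrite /sum2 -sumrB; apply: eq_bigr => i _; rewrite sumrB. Qed.

Lemma geometric_half K : \sum_(i < K) (2 ^ i)%:R^-1 = 2%:R - 2%:R * (2 ^ K)%:R^-1 :> rat.
Proof.
elim: K => [|K IH]; first by rewrite big_ord0 invr1 mulr1 subrr.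
rewrite big_ord_recr /= IH expnS natrM invfM mulrA divff ?mul1r //.
by move: (_^-1) => y; lra.
Qed.

Lemma sum2_weight K : sum2 K weight = (2%:R - 2%:R * (2 ^ K)%:R^-1) ^+ 2.
Proof.
rewrite -geometric_half expr2 mulr_suml; apply: eq_bigr => i _.
by rewrite mulr_sumr; apply: eq_bigr => j _; rewrite /weight expnD natrM invfM.
Qed.

Lemma pow2V_bounds K : 0 < ((2 ^ K)%:R^-1 : rat) <= 1.
Proof.
rewrite invr_gt0 ltr0n expn_gt0 /= invf_le1 ?ltr0n ?expn_gt0 //.
by rewrite ler1n expn_gt0.
Qed.

Lemma sum2_weight_le4 K : sum2 K weight <= 4%:R.
Proof.
by rewrite sum2_weight; have := pow2V_bounds K; move: (_^-1) => y /andP[y0 y1]; nra.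
Qed.

(** With [y = 2^-K] the sum over the small square is [(2 - 2 y)^2], hence at least [4 - 8 y]. *)
Lemma sum2_weight_tail K L : sum2 L weight - sum2 K weight <= 8%:R * (2 ^ K)%:R^-1.
Proof.
have := sum2_weight_le4 L; rewrite (sum2_weight K); have := pow2V_bounds K.
by move: (_^-1) => y /andP[y0 y1] le4; nra.
Qed.

Lemma xseqE t : xseq t = sum2 t (fun i j => weight i j * filled i j t).
Proof. by []. Qed.

Lemma xseq_sum2 K t : (K <= t)%N -> sum2 K (fun i j => weight i j * filled i j t) <= xseq t.
Proof.
by move=> le_K; apply: sum2_le => // i j; rewrite mulr_ge0 ?filled_ge0 // ltW ?weight_gt0.
Qed.

Lemma xseq_delta_upper K t t' : (K <= t)%N -> (t <= t')%N ->
  xseq t' - xseq t <= sum2 K (fun i j => weight i j * (filled i j t' - filled i j t))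
    + 8%:R * (2 ^ K)%:R^-1.
Proof.
move=> le_K le_t.
have E1 : sum2 K (fun i j => weight i j * (filled i j t' - filled i j t)) =
    sum2 K (fun i j => weight i j * filled i j t') - sum2 K (fun i j => weight i j * filled i j t).
  rewrite -sum2B; apply: eq_bigr => i _; apply: eq_bigr => j _; exact: mulrBr.
(* Comparing the unfilled weights at [t'] shows that the requests outside the square of side [K]
   contribute at most their full weight. *)
have d0 i j : 0 <= weight i j - weight i j * filled i j t'.
  by rewrite subr_ge0 ler_piMr ?filled_le1 // ltW ?weight_gt0.
have := sum2_le d0 (leq_trans le_K le_t); rewrite !sum2B -xseqE => H.
have le1 := xseq_sum2 le_K; have tail := sum2_weight_tail K t'.
rewrite E1; move: (8%:R * _) tail => y tail; lra.
Qed.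

Lemma xseq_delta_lower i j t t' : (i < t')%N -> (j < t')%N -> (t <= t')%N ->
  weight i j * (filled i j t' - filled i j t) <= xseq t' - xseq t.
Proof.
move=> lt_i lt_j le_t.
have d0 i' j' : 0 <= weight i' j' * (filled i' j' t' - filled i' j' t).
  by rewrite mulr_ge0 ?subr_ge0 ?filled_le // ltW ?weight_gt0.
apply: (@le_trans _ _ (sum2 t' (fun i j => weight i j * (filled i j t' - filled i j t)))).
  rewrite /sum2 (bigD1 (Ordinal lt_i)) //= (bigD1 (Ordinal lt_j)) //= -addrA lerDl.
  by rewrite addr_ge0 ?sumr_ge0 // => i' _; rewrite sumr_ge0.
rewrite xseqE.
have -> : sum2 t' (fun i j => weight i j * (filled i j t' - filled i j t)) =
    sum2 t' (fun i j => weight i j * filled i j t') -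
    sum2 t' (fun i j => weight i j * filled i j t).
  by rewrite -sum2B; apply: eq_bigr => i' _; apply: eq_bigr => j' _; exact: mulrBr.
rewrite lerD2l lerN2 xseqE.
apply: (sum2_le (a := fun i j => weight i j * filled i j t) _ le_t) => i' j'.
by rewrite mulr_ge0 ?filled_ge0 // ltW ?weight_gt0.
Qed.

Lemma xseq_le t t' : (t <= t')%N -> xseq t <= xseq t'.
Proof.
move=> le_t; apply: le_trans (xseq_sum2 le_t); rewrite xseqE.
by apply: sum2_mono => i j _ _; rewrite ler_wpM2l ?filled_le // ltW ?weight_gt0.
Qed.

Lemma xseq_le4 t : xseq t <= 4%:R.
Proof.
apply: le_trans (sum2_weight_le4 t); rewrite xseqE; apply: sum2_mono => i j _ _.
by rewrite ler_piMr ?filled_le1 // ltW ?weight_gt0.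
Qed.

Local Close Scope ring_scope.

(** * Near computability *)

Definition unbounded_clock (e : nat) : Prop := forall k, exists t, k < clock e t.

(** This case distinction is not effective, but it yields only a number, which a program may contain
    as a constant. *)
Lemma clock_dichotomy n : exists M, forall e, e < n ->
  unbounded_clock e \/ forall t, clock e t <= M.
Proof.
elim: n => [|n [M IH]]; first by exists 0.
have [un|/existsNP[k nk]] := pselect (unbounded_clock n).
  by exists M => e; rewrite ltnS leq_eqVlt => /orP[/eqP->|/IH//]; left.
exists (maxn M k) => e; rewrite ltnS leq_eqVlt => /orP[/eqP->|/IH[|le_M]]; [right|by left|right].
  move=> t; rewrite leqNgt; apply/negP => lt_t; apply: nk; exists t.
  by apply: leq_ltn_trans lt_t; rewrite leq_maxr.
by move=> t; rewrite (leq_trans (le_M t)) // leq_maxl.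
Qed.

Section NearlyComputable.
Variables (s : nat -> nat) (e : nat).
Hypotheses (s_incr : forall n, s n < s n.+1) (unb_e : unbounded_clock e).
Hypothesis s_clock : forall t a, a < clock e t -> s a < t.

(** Bounded clocks up to [e] stay at or below [M], so they are ignored by every request with [i] or
    [j] at least [M]. *)
Variable M : nat.
Hypothesis e_le_M : e <= M.
Hypothesis dich : forall e', e' < e.+1 -> unbounded_clock e' \/ forall t, clock e' t <= M.

(** From stage [T] on, the finitely many requests that a bounded clock may block are constant, and
    the test [clock i t <= M] tells the bounded clocks below [e] from the unbounded ones. *)
Variable T : nat.
Hypothesis stable : forall i j t, i < M -> j < M -> T <= t -> state i j t = state i j T.
Hypothesis late : forall i t, i < e -> unbounded_clock i -> T <= t -> M < clock i t.

(** After [T], outside the square of side [M], the second case means that the request is never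
    raised. In the third case with [i < e] the request is completely filled. *)
Definition settled (i j t1 t : nat) : bool :=
  [|| (i < M) && (j < M), (i < e) && (clock i t <= M) | fine_level i j e t1 t].

(** A decidable condition that persists once it holds. The bound [K + K] ensures that no request in
    the square ignores clock [e]. *)
Definition settled_upto (K t1 t : nat) : bool :=
  [&& T <= t, t1 <= t, K <= t, K + K < clock e t &
    all (fun i => all (fun j => settled i j t1 t) (iota 0 K)) (iota 0 K)].

Lemma leq_s n m : n <= m -> s n <= s m.
Proof.
move=> /subnK <-; elim: (m - n) => // k IH; apply: leq_trans IH _.
by rewrite addSn ltnW.
Qed.

Lemma s_ge n : n <= s n.
Proof. by elim: n => // n IH; apply: leq_ltn_trans IH (s_incr n). Qed.

Lemma settled_le i j t1 t t' : T <= t -> t1 <= t -> t <= t' ->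
  settled i j t1 t -> settled i j t1 t'.
Proof.
move=> le_T le_t1 le_t /or3P[H|/andP[lt_i le_M]|H]; apply/or3P.
- by constructor 1.
- constructor 2; rewrite lt_i.
  case: (dich (leqW lt_i)) => [un|->//].
  by have := late lt_i un le_T; rewrite ltnNge le_M.
- by constructor 3; exact: fine_level_le H.
Qed.

(** Outside the square of side [M] bounded clocks are ignored, so a raised request completes its
    loops up to [e] again and again. If [i < e] and clock [i] is unbounded, then it is raised and
    gets filled entirely. *)
Lemma settled_eventually i j t1 : exists t0, forall t, t0 <= t -> settled i j t1 t.
Proof.
suff [t0 le_t0 H0] : exists2 t0, maxn T t1 <= t0 & settled i j t1 t0.
  exists t0 => t le_t; apply: settled_le H0 => //; apply: leq_trans le_t0; lia.
have [/andP[lt_i lt_j]|nexc] := boolP ((i < M) && (j < M)).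
  by exists (maxn T t1); rewrite // /settled lt_i lt_j.
have le_M : M <= i + j by move: nexc; lia.
have goodE n : e < n -> recurs_zero i j n -> exists2 t0, maxn T t1 <= t0 & settled i j t1 t0.
  move=> lt_n Z; have [t0 le_t0 z] := Z (maxn T t1); exists t0 => //.
  by apply/or3P; constructor 3; apply: fine_level_zero => e' lt_e'; apply: z; apply: leq_trans lt_n.
have progress n : n <= e.+1 -> n <= i.+2 -> (exists t, j < clock i t) -> recurs_zero i j n.
  move=> le_n le_ni asked; apply: recurs_zero_progress => // e' lt_e' _.
  case: (dich (leq_trans lt_e' le_n)) => [|bnd]; [by left|right=> t].
  exact: leq_trans (bnd t) le_M.
have [lt_ie|le_ei] := ltnP i e; last first.
  have [asked|nasked] := pselect (exists t, j < clock i t).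
    by apply: (goodE e.+1) => //; apply: progress => //; lia.
  apply: (goodE i.+1); first by lia.
  apply: recurs_zero_unasked => t; rewrite leqNgt; apply/negP => lt_t.
  by apply: nasked; exists t.
case: (dich (leqW lt_ie)) => [un|bnd]; last first.
  by exists (maxn T t1) => //; apply/or3P; constructor 2; rewrite lt_ie bnd.
have Z := progress i.+2 lt_ie (leqnn _) (un j).
have [t0 le_t0 z] := Z (maxn T t1); exists t0 => //.
apply/or3P; constructor 3; apply: fine_level_zero => e' _.
have [/z//|ge_e'] := ltnP e' i.+2; exact: cnt_state_out.
Qed.

Lemma settled_upto_eventually K t1 : exists n, settled_upto K t1 (s n).
Proof.
have [T1 H1] : exists T1, forall i, i < K -> forall t, T1 <= t ->
    forall j, j < K -> settled i j t1 t.
  apply: eventually_all => i _.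
  have [T1 H1] := @eventually_all K (fun j t => settled i j t1 t)
    (fun j _ => settled_eventually i j t1).
  by exists T1 => t le_t j lt_j; exact: H1.
have [t2 H2] := unb_e (K + K).
pose n := T + t1 + K + T1 + t2; have := s_ge n; rewrite {1}/n => le_n.
exists n; apply/and5P; split; try lia.
  by apply: leq_trans H2 (clock_le _ _); lia.
apply/allP => i; rewrite mem_iota => lt_i; apply/allP => j; rewrite mem_iota => lt_j.
by apply: H1 => //; lia.
Qed.

Lemma settled_upto_le K t1 t t' : t <= t' -> settled_upto K t1 t -> settled_upto K t1 t'.
Proof.
move=> le_t /and5P[le_T le_t1 le_K big /allP H]; apply/and5P; split.
- exact: leq_trans le_T le_t.
- exact: leq_trans le_t1 le_t.
- exact: leq_trans le_K le_t.
- exact: leq_trans big (clock_le _ le_t).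
apply/allP => i /H/allP Hi; apply/allP => j /Hi; exact: settled_le.
Qed.

Local Open Scope ring_scope.

Lemma settled_filled K t1 n i j : settled_upto K t1 (s n) -> (i < K)%N -> (j < K)%N ->
  filled i j (s n.+1) - filled i j (s n) <= t1.+1%:R^-1.
Proof.
move=> /and5P[le_T le_t1 le_K big /allP H] lt_i lt_j.
have B0 : 0 <= t1.+1%:R^-1 :> rat by rewrite invr_ge0.
have le_s := ltnW (s_incr n).
have {}H : settled i j t1 (s n).
  have /H/allP/(_ j) : i \in iota 0 K by rewrite mem_iota.
  by rewrite mem_iota; apply.
have [/andP[iM jM]|nexc] := boolP ((i < M) && (j < M))%N.
  by rewrite /filled !(stable iM jM) ?subrr //; apply: leq_trans le_s.
case/or3P: H => [H|/andP[lt_ie le_M]|gd]; first by rewrite H in nexc.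
  have bnd : forall t, (clock i t <= j)%N.
    case: (dich (leqW lt_ie)) => [un|bnd t].
      by have := late lt_ie un le_T; rewrite ltnNge le_M.
    by apply: leq_trans (bnd t) _; move: nexc; lia.
  by rewrite !filled_unasked // subrr.
have [le_ei|lt_ie] := leqP e i.
  apply: filled_delta le_ei le_s le_t1 _ _ gd; first by apply: leq_ltn_trans big; lia.
  (* If clock [e] exceeded [a] at stage [u], then [s a < s n.+1]; but [a > s n >= n] gives
     [s n.+1 <= s a]. *)
  move=> a u lt_a lt_u; rewrite leqNgt; apply/negP => /s_clock lt_sa.
  have : (s a < s n.+1)%N := ltn_trans lt_sa lt_u.
  rewrite ltnNge => /negP; apply; apply: leq_s; rewrite ltnNge; apply/negP => /leq_s.
  by have := s_ge a; lia.
case/orP: gd => [/andP[]|/allP z]; first by rewrite leqNgt lt_ie.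
rewrite [filled i j (s n)]filled_zero; last first.
  by move=> e' lt_e'; apply/eqP; apply: z; rewrite mem_iota; lia.
by apply: le_trans B0; rewrite subr_le0 filled_le1.
Qed.

(** The square contributes at most [4 / 2^(k+5)] and the requests outside it at most [8 / 2^(k+5)],
    together [12 / 32] of [2^-k]. *)
Lemma settled_xseq k n : settled_upto (k + 5) (2 ^ (k + 5)) (s n) ->
  xseq (s n.+1) - xseq (s n) < (2 ^ k)%:R^-1.
Proof.
move=> H; have /and5P[_ _ le_K _ _] := H.
apply: le_lt_trans (xseq_delta_upper le_K (ltnW (s_incr n))) _.
set t1 := (2 ^ (k + 5))%N in H *.
have le1 : sum2 (k + 5) (fun i j => weight i j * (filled i j (s n.+1) - filled i j (s n)))
    <= 4%:R * t1.+1%:R^-1.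
  apply: (@le_trans _ _ (sum2 (k + 5) weight * t1.+1%:R^-1)).
    rewrite /sum2 mulr_suml; apply: ler_sum => i _; rewrite mulr_suml; apply: ler_sum => j _.
    by rewrite ler_wpM2l ?(ltW (weight_gt0 _ _)) //; exact: settled_filled H _ _.
  by rewrite ler_wpM2r ?sum2_weight_le4 ?invr_ge0.
have le2 : t1.+1%:R^-1 <= (2 ^ (k + 5))%:R^-1 :> rat.
  by rewrite lef_pV2 ?posrE ?ltr0n ?expn_gt0 // ler_nat leqnSn.
have E : (2 ^ (k + 5))%:R^-1 = (2 ^ k)%:R^-1 / 32%:R :> rat.
  by rewrite expnD natrM invfM.
rewrite -/t1 E in le2 *.
have p0 : 0 < (2 ^ k)%:R^-1 :> rat by rewrite invr_gt0 ltr0n expn_gt0.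
move: (2 ^ k)%:R^-1 (t1.+1%:R^-1) (sum2 _ _) le1 le2 p0 => y z u le1 le2 p0.
lra.
Qed.
End NearlyComputable.

Local Open Scope classical_set_scope.
Local Open Scope ring_scope.

(** * Passage between environments and functions of one variable *)

Lemma computable_natP (f : nat -> nat) :
  computable_nat f <-> Comp (fun z : unit * nat => f z.2).
Proof.
by split=> -[p Hp]; exists p; [case=> -[] n; exact: Hp | move=> n; exact: (Hp (tt, n))].
Qed.

Lemma computable_qseqP (q : nat -> rat) :
  computable_qseq q <-> QComp (fun z : unit * nat => q z.2).
Proof.
split=> [[a [b [c [/computable_natP Ca /computable_natP Cb /computable_natP Cc E]]]]|].
  by exists (fun z => a z.2), (fun z => b z.2), (fun z => c z.2).
move=> [a [b [c [Ca Cb Cc E]]]].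
have CE (f : unit * nat -> nat) : Comp f -> computable_nat (fun n => f (tt, n)).
  by move=> Cf; apply/computable_natP; apply: Comp_ext Cf => -[[] n].
exists (fun n => a (tt, n)), (fun n => b (tt, n)), (fun n => c (tt, n)).
by split; [exact: CE | exact: CE | exact: CE | move=> n; exact: (E (tt, n))].
Qed.

(** The modulus searches for the first [n] at which [settled_upto] holds at [s n]; the numbers [e],
    [M] and [T] enter its program as constants. *)
Lemma xseq_modulus (s : nat -> nat) : computable_nat s -> (forall n, (s n < s n.+1)%N) ->
  exists2 f, computable_nat f & forall k n, (f k <= n)%N ->
    xseq (s n.+1) - xseq (s n) < (2 ^ k)%:R^-1.
Proof.
move=> Cs s_incr; have [e [unb_e s_clock]] := clock_total Cs.
have [M0 dich0] := clock_dichotomy e.+1.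
(* With [e <= M], a request outside the square of side [M] with [i < e] has [j >= M]. *)
pose M := maxn M0 e.
have le_eM : (e <= M)%N by rewrite leq_maxr.
have dich e' : (e' < e.+1)%N -> unbounded_clock e' \/ forall t, (clock e' t <= M)%N.
  case/dich0 => [|bnd]; [by left | right => t].
  by apply: leq_trans (bnd t) _; rewrite leq_maxl.
have [T1 H1] : exists T1, forall i, (i < M)%N -> forall t, (T1 <= t)%N ->
    forall j, (j < M)%N -> forall t', (T1 <= t')%N -> state i j t = state i j t'.
  have [i _|T1 H1] := @eventually_all M (fun i t => forall j, (j < M)%N ->
      forall t', (t <= t')%N -> state i j t = state i j t').
    have [j _|T1 H1] := @eventually_all M (fun j t => forall t', (t <= t')%N ->
        state i j t = state i j t').
      have [T1 H1] := state_stabilizes i j; exists T1 => t le_t t' le_t'.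
      by rewrite H1 // H1 // (leq_trans le_t).
    by exists T1 => t le_t j lt_j; apply: H1.
  exists T1 => i lt_i t le_t j lt_j t' le_t'.
  by rewrite -(H1 _ lt_i _ (leqnn _) _ lt_j _ le_t) -(H1 _ lt_i _ (leqnn _) _ lt_j _ le_t').
have [T2 H2] : exists T2, forall i, (i < e)%N -> forall t, (T2 <= t)%N ->
    unbounded_clock i -> (M < clock i t)%N.
  apply: eventually_all => i _.
  have [un|nun] := pselect (unbounded_clock i); last by exists 0%N => t _ /nun.
  have [T2 H2] := un M; exists T2 => t le_t _; exact: leq_trans H2 (clock_le _ le_t).
pose T := maxn T1 T2.
have stable i j t : (i < M)%N -> (j < M)%N -> (T <= t)%N -> state i j t = state i j T.
  move=> lt_i lt_j le_t; apply: H1 => //; rewrite ?leq_maxl //.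
  by apply: leq_trans le_t; rewrite leq_maxl.
have late i t : (i < e)%N -> unbounded_clock i -> (T <= t)%N -> (M < clock i t)%N.
  move=> lt_i un le_t; apply: H2 => //.
  by apply: leq_trans le_t; rewrite leq_maxr.
pose P k n := settled_upto e M T (k + 5) (2 ^ (k + 5)) (s n).
have exP k : exists n, P k n by exact: settled_upto_eventually.
exists (fun k => ex_minn (exP k)).
  apply/computable_natP.
  apply: (Comp_mu (P := fun z n => P z.2 n)).
  - by move=> z; case: ex_minnP.
  - move=> z n; case: ex_minnP => m _ min_m; apply: contraL => /min_m.
    by rewrite leqNgt.
  have Csn : Comp (fun z : unit * nat * nat => s z.2).
    by apply: (Comp_app1 (k := s)); [exact/computable_natP | comp].
  rewrite /P /settled_upto /settled /fine_level.
  have Csn1 := Comp_weak Csn; have Csn2 := Comp_weak Csn1; have Csn3 := Comp_weak Csn2.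
  repeat (cbv beta; first [comp_step | refine (Comp_state _ _ _)]).
move=> k n; case: ex_minnP => m Pm _ le_m.
apply: (settled_xseq s_incr s_clock le_eM dich stable late).
exact: (settled_upto_le dich late (leq_s s_incr le_m) Pm).
Qed.

(** * Failure of regaining approximability *)

Lemma pow2V_ratr (R : realType) k : ratr ((2 ^ k)%:R^-1) = 2%:R ^- k :> R.
Proof. by rewrite fmorphV /= ratr_nat natrX. Qed.

Lemma ratr_seq_le_lim (R : realType) (q : nat -> rat) (x : R) : nondecreasing_qseq q ->
  (fun n => (ratr (q n) : R)) @ \oo --> x -> forall n, ratr (q n) <= x.
Proof.
move=> ndq qx n; have <- := cvg_lim (@Rhausdorff R) qx.
apply: nondecreasing_cvgn_le; last by apply/cvg_ex; exists x.
by apply/nondecreasing_seqP => m; rewrite ler_rat.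
Qed.

Lemma xseq_not_regaining (R : realType) (x : R) :
  (fun n => (ratr (xseq n) : R)) @ \oo --> x -> ~ regainingly_approximable x.
Proof.
move=> xx [q [/computable_qseqP Cq ndq qx io]].
have x_ge := ratr_seq_le_lim (fun n => xseq_le (leqnSn n)) xx.
have q_le := ratr_seq_le_lim ndq qx.
pose P n t := q n - (2 ^ n)%:R^-1 < xseq t.
have exP n : exists t, P n t.
  have : ratr (q n - (2 ^ n)%:R^-1) < x.
    by apply: lt_le_trans (q_le n); rewrite ltr_rat ltrBlDr ltrDl invr_gt0 ltr0n expn_gt0.
  move=> /(cvgr_gt _ xx)[N _ HN]; exists N.
  by rewrite /P -(ltr_rat R); apply: HN => /=.
pose r n := ex_minn (exP n).
have rP n : P n (r n) by rewrite /r; case: ex_minnP.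
have Cr (A : Type) (EA : Env A) (f : A -> nat) : Comp f -> Comp (fun a => r (f a)).
  apply: Comp_app1; apply: (Comp_mu (P := fun z t => P z.2 t)).
  - by move=> z; apply: rP.
  - move=> z n; rewrite /r; case: ex_minnP => m _ min_m; apply: contraL => /min_m.
    by rewrite leqNgt.
  have [a [b [c [Ca Cb Cc E]]]] := Cq.
  apply: Comp_ltq; last by apply: QComp_xseq; comp.
  apply: QComp_sub; last by apply: QComp_inv; comp.
  exists (fun z => a z.1), (fun z => b z.1), (fun z => c z.1).
  by split; [exact: Comp_weak | exact: Comp_weak | exact: Comp_weak | move=> z; exact: E].
(* The sum is at least [r n] for both [n] that are sent to [j] by [n.-1./2]. *)
have Cg : computable_nat (fun j => r j.*2.+1 + r j.*2.+2)%N.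
  apply/computable_natP; apply: Comp_add; apply: Cr; do 2?apply: Comp_succ;
  by apply: (Comp_ext (g := fun z => z.2 + z.2)%N); [move=> z; rewrite addnn | comp].
have [i [unb_i clk]] := clock_total Cg.
have [M dich] := clock_dichotomy i.+1.
(* So large an [n] makes [j] at least [i + M]; then bounded clocks up to [i] are ignored by request
   [(i, j)], which is thus filled. *)
have [n le_n close] := io (2 * (i + M)).+2.
pose j := n.-1./2.
have [le_ij le_Mj n_ge] : [/\ (i <= j)%N, (M <= j)%N & (j.*2.+1 <= n)%N] by rewrite /j; split; lia.
have le_r : (r n <= r j.*2.+1 + r j.*2.+2)%N.
  have [->|->] : n = j.*2.+1 \/ n = j.*2.+2 by rewrite /j; lia.
    exact: leq_addr.
  exact: leq_addl.
have f0 : filled i j (r n) = 0.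
  apply: filled_unasked; rewrite leqNgt; apply/negP => /clk.
  by rewrite ltnNge le_r.
have Z : recurs_zero i j i.+2.
  apply: recurs_zero_progress => // e' lt_e' le_e'.
  case: (dich e' le_e') => [|bnd]; [by left | right => t].
  by apply: leq_trans (bnd t) _; lia.
have [t' le_t' z] := Z (r n + i.+1 + j.+1)%N.
have f1 : filled i j t' = 1 := filled_zero z.
have := @xseq_delta_lower i j (r n) t'; rewrite f0 f1 subr0 mulr1 => lower.
have {}lower : weight i j <= xseq t' - xseq (r n) by apply: lower; lia.
(* This is [i + j <= 2 j <= n - 1] in the exponents. *)
have wt_ge : 2%:R * (2 ^ n)%:R^-1 <= weight i j.
  have -> : 2%:R * (2 ^ n)%:R^-1 = (2 ^ n.-1)%:R^-1 :> rat.
    rewrite -{1}(@prednK n); last by lia.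
    by rewrite expnS natrM invfM mulrA divff // mul1r.
  rewrite /weight lef_pV2 ?posrE ?ltr0n ?expn_gt0 // ler_nat leq_exp2l //; lia.
have := x_ge t'; have := rP n; rewrite /P -(ltr_rat R) rmorphB /= pow2V_ratr => H1 H2.
move: lower; rewrite -(ler_rat R) rmorphB /= => H3.
have H4 : 2%:R * 2%:R ^- n <= ratr (weight i j) :> R.
  by rewrite -pow2V_ratr -(ratr_nat R 2) -rmorphM ler_rat.
(* By [close] and [H1], [x] is below [xseq (r n) + 2 / 2^n], hence below [xseq t'], which is at most
   [x]. *)
suff : x < x by rewrite ltxx.
by move: (2%:R ^- n) close H1 H4 => y close H1 H4; lra.
Qed.

Theorem theorem3p2 (R : realType) :
  exists x : R, left_computable x /\ nearly_computable x /\ ~ regainingly_approximable x.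
Proof.
have ndx : nondecreasing_qseq xseq by move=> n; apply: xseq_le.
have Cx : computable_qseq xseq.
  by apply/computable_qseqP; apply: QComp_xseq; comp.
have [x xx] : exists x : R, (fun n => (ratr (xseq n) : R)) @ \oo --> x.
  apply/cvg_ex; apply: nondecreasing_is_cvgn.
    by apply/nondecreasing_seqP => m; rewrite ler_rat xseq_le.
  by exists (ratr 4%:R) => _ [n _ <-]; rewrite ler_rat xseq_le4.
exists x; split; first by exists xseq.
split; last exact: xseq_not_regaining.
exists xseq; split=> //; split=> // s Cs s_incr.
have [f Cf Hf] := xseq_modulus Cs s_incr; exists f; split=> // k n /Hf lt_k.
have le0 : xseq (s n) <= xseq (s n.+1) by apply: xseq_le; apply: ltnW.
rewrite sub0r normrN ger0_norm ?subr_ge0 ?ler_rat //.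
by rewrite -rmorphB -pow2V_ratr ltr_rat.
Qed.
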